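(* Given a voting correspondence $h:Z\to 2^A$, relabel its planes such that for all $i\in I$ the sequence $(s_h(i,z,a)\mid z=0,1,\dots,\alpha_i)$ is monotone non-decreasing. Then $h$ is a DAV correspondence if and only if, after this relabeling, for all $(z_1,\dots,z_n)\in Z$ $$h(z_1,\dots,z_n)=\begin{cases}\{a\}&\text{if }\sum_{i\in I}z_i>\sigma/2,\\ \{a,b\}&\text{if }\sum_{i\in I}z_i=\sigma/2,\\ \{b\}&\text{if }\sum_{i\in I}z_i<\sigma/2.\end{cases}$$ Computing $s_h(i,z,a)$ for all $i\in I$, $z\in\mathbb{Z}_{\alpha_i}$, relabeling the planes, and checking for all $(z_1,\dots,z_n)\in Z$ whether $h(z_1,\dots,z_n)$ equals $\{a\}$ if $\sum_{i\in I}z_i>\sigma/2$, equals $\{a,b\}$ if $\sum_{i\in I}z_i=\sigma/2$, and equals $\{b\}$ if $\sum_{i\in I}z_i<\sigma/2$, can be done in $O\left(\prod_{i\in I}(\alpha_i+1)\right)$ time.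
   Context: There are two candidates, $A=\{a,b\}$, and $n\ge 2$ voters $I=\{1,\dots,n\}$; voter $i$ has $\alpha_i\ge 1$ voting cards. Put $\mathbb{Z}_{\alpha_i}=\{0,1,\dots,\alpha_i\}$, $Z=\mathbb{Z}_{\alpha_1}\times\cdots\times\mathbb{Z}_{\alpha_n}$ and $\sigma=\sum_{i\in I}\alpha_i$. The integer $z_i\in\mathbb{Z}_{\alpha_i}$ denotes the strategy of voter $i$ giving $z_i$ cards to $a$ and $\alpha_i-z_i$ cards to $b$. For a vector $v\in\mathbb{Z}^A$, $AM(v)$ is the set of candidates with the maximum coordinate. A voting correspondence is a map (an $n$-dimensional array) $h:Z\to 2^A$. It is a distributed approval voting (DAV) correspondence if there are permutations $\pi_i$ of $\mathbb{Z}_{\alpha_i}$, $i\in I$ (labelings of the index values by strategies), such that $h(z_1,\dots,z_n)=AM\left(\sum_{i\in I}(\pi_i(z_i),\alpha_i-\pi_i(z_i))\right)$ for all $(z_1,\dots,z_n)\in Z$. The plane $h_{i,z}$ is the $(n-1)$-dimensional subarray of $h$ obtained by fixing the $i$th coordinate at $z$ and varying all other coordinates; relabeling the planes means permuting, for each $i\in I$, the values of the $i$th coordinate. For $i\in I$, $z\in\mathbb{Z}_{\alpha_i}$, $c\in A$: $s_h(i,z,c)=|\{(z_1,\dots,z_n)\in Z : z_i=z,\ c\in h(z_1,\dots,z_n)\}|$.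
   Formalization: If σ is even and some α_i > σ/2, a monotone relabeling may misorder distinct planes with equal s_h(i,z,a), and the equivalence fails (e.g. α=(3,1)); the formal equivalence orders such ties by non-increasing s_h(i,z,b), and also gives a version for some monotone relabeling. *)

(* Defs.v *)
From HB Require Import structures.
From mathcomp Require Import all_boot all_order all_fingroup all_algebra.

Set Implicit Arguments.
Unset Strict Implicit.
Unset Printing Implicit Defensive.

Import Order.TTheory GRing.Theory Num.Theory.

(** * Voting correspondences for two candidates (MathComp) *)

Notation candidate := bool.
Notation cand_a := true (only parsing).
Notation cand_b := false (only parsing).

(* Voters are 'I_n, numbered from 0; alpha i is the number of cards of i. *)
Definition profile (n : nat) (alpha : 'I_n -> nat) :=
  {dffun forall i : 'I_n, 'I_(alpha i).+1}.

Definition voting (n : nat) (alpha : 'I_n -> nat) :=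
  profile alpha -> {set candidate}.

Definition sigma (n : nat) (alpha : 'I_n -> nat) : nat := \sum_(i < n) alpha i.

Definition AM (v : {ffun candidate -> int}) : {set candidate} :=
  [set c | [forall d, (v d <= v c)%R]].

(* The vector (k, m - k): k of the m cards go to a, the other ones to b. *)
Definition ballot (m k : nat) : {ffun candidate -> int} :=
  [ffun c => if c == cand_a then (k%:Z)%R else (m%:Z - k%:Z)%R].

Definition labeling (n : nat) (alpha : 'I_n -> nat) :=
  forall i : 'I_n, {perm 'I_(alpha i).+1}.

Definition is_DAV (n : nat) (alpha : 'I_n -> nat) (h : voting alpha) : Prop :=
  exists pi : labeling alpha,
    forall z : profile alpha,
      h z = AM (\sum_(i < n) ballot (alpha i) (pi i (z i)))%R.

Definition s_count (n : nat) (alpha : 'I_n -> nat) (h : voting alpha)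
    (i : 'I_n) (k : 'I_(alpha i).+1) (c : candidate) : nat :=
  #|[set z : profile alpha | (z i == k) && (c \in h z)]|.

(* Plane k of voter i of the relabeled array is plane rho i k of h. *)
Definition relabel_profile (n : nat) (alpha : 'I_n -> nat)
    (rho : labeling alpha) (z : profile alpha) : profile alpha :=
  [ffun i : 'I_n => rho i (z i)].

Definition relabel (n : nat) (alpha : 'I_n -> nat) (h : voting alpha)
    (rho : labeling alpha) : voting alpha :=
  fun z => h (relabel_profile rho z).

Definition a_monotone (n : nat) (alpha : 'I_n -> nat) (h : voting alpha) : Prop :=
  forall (i : 'I_n) (k l : 'I_(alpha i).+1),
    k <= l -> s_count h k cand_a <= s_count h l cand_a.

(* Equal values of s_h(i, ., a) may belong to different planes in exactly one
   situation for a DAV correspondence: sigma is even and voter i holds more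
   than sigma / 2 cards.  For alpha = (3, 1), planes 2 and 3 of the first voter
   are ({a,b}, {a}) and ({a}, {a}): both have s(., a) = 2, so monotonicity does
   not determine their order.  For such voters only, equal values are to be
   ordered by non-increasing s_h(i, ., b). *)
Definition ties_ordered (n : nat) (alpha : 'I_n -> nat) (h : voting alpha) : Prop :=
  forall i : 'I_n, ~~ odd (sigma alpha) -> sigma alpha < 2 * alpha i ->
  forall k l : 'I_(alpha i).+1, k <= l ->
    s_count h k cand_a = s_count h l cand_a ->
    s_count h l cand_b <= s_count h k cand_b.

Definition majority (n : nat) (alpha : 'I_n -> nat) (z : profile alpha) :
    {set candidate} :=
  let total : rat := ((\sum_(i < n) (z i : nat))%:R)%R in
  let half : rat := ((sigma alpha)%:R / 2%:R)%R in
  if (half < total)%R then [set cand_a]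
  else if total == half then [set cand_a; cand_b]
  else [set cand_b].

(** * Random access machines

    Programs are while-programs over registers and an addressable memory, both
    containing natural numbers.  Every operation, memory access and test has
    unit cost.  A run with word bound W may only ever compute numbers that are
    at most W (addresses included); it is stuck otherwise. *)

Inductive arith := Add | Sub | Mul.

Inductive expr :=
| Const of nat
| Reg of nat
| Op of arith & expr & expr
| Read of expr.

Inductive prog :=
| Skip
| Assign of nat & expr
| Write of expr & expr
| Seq of prog & prog
| If of expr & prog & prog
| While of expr & prog.

Record state := State { regs : nat -> nat; mem : nat -> nat }.

Definition upd (f : nat -> nat) (x v : nat) : nat -> nat :=
  fun y => if y == x then v else f y.

(* Subtraction is truncated at 0, so Sub followed by a test compares numbers. *)
Definition apply_arith (o : arith) (x y : nat) : nat :=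
  match o with Add => x + y | Sub => x - y | Mul => x * y end.

Fixpoint eval (s : state) (e : expr) : nat :=
  match e with
  | Const k => k
  | Reg x => regs s x
  | Op o e1 e2 => apply_arith o (eval s e1) (eval s e2)
  | Read e1 => mem s (eval s e1)
  end.

Fixpoint fits (W : nat) (s : state) (e : expr) : bool :=
  (eval s e <= W) &&
  match e with
  | Const _ | Reg _ => true
  | Op _ e1 e2 => fits W s e1 && fits W s e2
  | Read e1 => fits W s e1
  end.

Fixpoint cost (e : expr) : nat :=
  match e with
  | Const _ | Reg _ => 1
  | Op _ e1 e2 => (cost e1 + cost e2).+1
  | Read e1 => (cost e1).+1
  end.

(* exec W p s t s' : p started in s halts in s' after t time units. *)
Inductive exec (W : nat) : prog -> state -> nat -> state -> Prop :=
| ExecSkip s : exec W Skip s 1 s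
| ExecAssign x e s :
    fits W s e ->
    exec W (Assign x e) s (cost e).+1 (State (upd (regs s) x (eval s e)) (mem s))
| ExecWrite e1 e2 s :
    fits W s e1 -> fits W s e2 ->
    exec W (Write e1 e2) s (cost e1 + cost e2).+1
         (State (regs s) (upd (mem s) (eval s e1) (eval s e2)))
| ExecSeq p1 p2 s1 s2 s3 t1 t2 :
    exec W p1 s1 t1 s2 -> exec W p2 s2 t2 s3 ->
    exec W (Seq p1 p2) s1 (t1 + t2) s3
| ExecIfTrue e p1 p2 s t s' :
    fits W s e -> eval s e != 0 -> exec W p1 s t s' ->
    exec W (If e p1 p2) s (cost e + t).+1 s'
| ExecIfFalse e p1 p2 s t s' :
    fits W s e -> eval s e == 0 -> exec W p2 s t s' ->
    exec W (If e p1 p2) s (cost e + t).+1 s'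
| ExecWhileTrue e p s1 t1 s2 t2 s3 :
    fits W s1 e -> eval s1 e != 0 ->
    exec W p s1 t1 s2 -> exec W (While e p) s2 t2 s3 ->
    exec W (While e p) s1 (cost e + t1 + t2).+1 s3
| ExecWhileFalse e p s :
    fits W s e -> eval s e == 0 ->
    exec W (While e p) s (cost e).+1 s.

(** * Memory representation of arrays and tables *)

Definition num_profiles (n : nat) (alpha : 'I_n -> nat) : nat :=
  \prod_(i < n) (alpha i).+1.

(* Row-major position of a cell of an n-dimensional array. *)
Definition address (n : nat) (alpha : 'I_n -> nat) (z : profile alpha) : nat :=
  \sum_(i < n) z i * \prod_(j < n | i < j) (alpha j).+1.

(* Position of the pair (i, k) in a table listing the planes voter by voter. *)
Definition plane_address (n : nat) (alpha : 'I_n -> nat)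
    (i : 'I_n) (k : 'I_(alpha i).+1) : nat :=
  \sum_(j < n | j < i) (alpha j).+1 + k.

Definition code (S : {set candidate}) : nat :=
  (cand_a \in S) + 2 * (cand_b \in S).

Definition array_at (n : nat) (alpha : 'I_n -> nat) (m : nat -> nat)
    (base : nat) (h : voting alpha) : Prop :=
  forall z : profile alpha, m (base + address z) = code (h z).

Definition table_at (n : nat) (alpha : 'I_n -> nat) (m : nat -> nat)
    (base : nat) (f : forall i : 'I_n, 'I_(alpha i).+1 -> nat) : Prop :=
  forall (i : 'I_n) (k : 'I_(alpha i).+1),
    m (base + plane_address k) = f i k.

(* The input is n, alpha_1, ..., alpha_n and the array h, in consecutive
   cells; everything else is 0. *)
Definition input_state (n : nat) (alpha : 'I_n -> nat) (h : voting alpha)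
    (s : state) : Prop :=
  [/\ mem s 0 = n,
      forall i : 'I_n, mem s i.+1 = alpha i,
      array_at (mem s) n.+1 h,
      forall x, n + num_profiles alpha < x -> mem s x = 0
    & forall r, regs s r = 0].

(* Register 0 holds the outcome of the check of the relabeled array; registers
   1, 2 and 3 point to the values s_h(i, z, a), to the relabeling rho and to
   the relabeled array. *)
Definition output_state (n : nat) (alpha : 'I_n -> nat) (h : voting alpha)
    (rho : labeling alpha) (s : state) : Prop :=
  [/\ regs s 0 = [forall z : profile alpha, relabel h rho z == majority z],
      table_at (mem s) (regs s 1)
        (fun (i : 'I_n) (k : 'I_(alpha i).+1) => s_count h k cand_a),
      table_at (mem s) (regs s 2)
        (fun (i : 'I_n) (k : 'I_(alpha i).+1) => rho i k : nat)
    & array_at (mem s) (regs s 3) (relabel h rho)].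

(* Main.v *)
Require Import Defs.
From mathcomp Require Import all_boot all_order all_fingroup all_algebra.
From mathcomp Require Import zify.

Set Implicit Arguments.
Unset Strict Implicit.
Unset Printing Implicit Defensive.

(** In the majority array replacing k by l >= k as the index of a voter can
    only add a to an outcome and remove b from it. So two planes of a voter
    with the same numbers s(i, ., a) and s(i, ., b) are equal, and a sorted
    relabeling of the majority array can only permute equal planes. Here
    s(i, ., a) determines s(i, ., b): if sigma is odd no outcome is {a, b},
    and if 2 alpha_i <= sigma then s(i, ., a) is strictly increasing,
    because the cards of the other voters can be dealt so that voter i is
    pivotal. In the remaining case equal values of s(i, ., a) are ordered by
    s(i, ., b).

    For the time bound let N be the number of profiles. The numbers s(i, k,
    a) come from summing the array over one voter after the other: as every
    voter has at least two planes, the successive arrays have total size at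
    most 2N. The planes of all voters are sorted together by three stable
    bucket sorts with N + 1 buckets, on the number of outcomes without b,
    then on the number of outcomes with a, then on the voter; sorting one
    voter at a time would take N / m buckets for each voter with m planes,
    too many in total. The addresses of the cells of the relabeled array,
    and the numbers of cards for a, are built by the reverse of the
    summation. *)

(* ssrbool also has a constant mem. *)
Local Notation mem := Defs.mem.

(** * Voting correspondences and the majority array *)

(** The given sorted relabeling [rho] and the labeling [pi] of a DAV correspondence are unrelated,
    and their composite [tau] need not be the identity, since different planes of the majority array
    may coincide as arrays. Uniqueness is therefore proved only for the sequence of pairs of counts,
    from the fact that a finite sequence has just one sorted arrangement.

    The program is shaped by a machine without division whose words are bounded by a constant times
    N. Quotients and remainders are maintained by counting down. All tables have O(N) cells, because
    a sum of integers that are at least 2 is at most their product, so that there are at most N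
    planes. Running time is an argument of every postcondition, so one loop invariant gives both
    correctness and cost. The constant 8000 bounds the total time per profile with room to spare; as
    word bound it also covers the 31 * 4 N cells that the layout asks for. *)

Definition votes_a (n : nat) (alpha : 'I_n -> nat) (z : profile alpha) : nat :=
  \sum_(i < n) z i.

Section Outcomes.
Import GRing.Theory Num.Theory.

(** Clearing the denominator of $\sigma/2$ leaves only comparisons of natural numbers from here on,
    with a separate criterion for each candidate. *)
Lemma majorityE (n : nat) (alpha : 'I_n -> nat) (z : profile alpha) :
  (cand_a \in majority z) = (sigma alpha <= 2 * votes_a z) /\
  (cand_b \in majority z) = (2 * votes_a z <= sigma alpha).
Proof.
have two : (0 < 2%:R :> rat)%R by [].
have lt : ((sigma alpha)%:R / 2%:R < (votes_a z)%:R :> rat)%R = (sigma alpha < 2 * votes_a z).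
  by rewrite ltr_pdivrMr // mulrC -natrM ltr_nat.
have eq : ((votes_a z)%:R == (sigma alpha)%:R / 2%:R :> rat)%R = (2 * votes_a z == sigma alpha).
  have n2 := lt0r_neq0 two.
  by rewrite -(inj_eq (mulIf n2)) divfK // mulrC -natrM eqr_nat.
rewrite /majority -/(votes_a z) lt eq.
by case: ltngtP; rewrite !inE.
Qed.

(** The ballots add up to [votes_a z] for a and [sigma alpha - votes_a z] for b. So a DAV
    correspondence is a relabeled majority array. *)
Lemma AM_majority (n : nat) (alpha : 'I_n -> nat) (z : profile alpha) :
  AM (\sum_(i < n) ballot (alpha i) (z i))%R = majority z.
Proof.
have [ma mb] := majorityE z.
have E c : (\sum_(i < n) ballot (alpha i) (z i))%R c =
  (if c then (votes_a z)%:Z else (sigma alpha)%:Z - (votes_a z)%:Z)%R.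
  have PE (F : 'I_n -> nat) : Posz (\sum_(i < n) F i) = (\sum_(i < n) (F i)%:Z)%R
    by apply: (big_morph Posz PoszD).
  rewrite sum_ffunE /votes_a /sigma !PE; case: c.
    by apply: eq_bigr => i _; rewrite ffunE.
  by rewrite -sumrB; apply: eq_bigr => i _; rewrite ffunE.
apply/setP => -[]; rewrite ?ma ?mb inE.
- apply/forallP/idP => [/(_ false)|h [|]]; rewrite !E; lia.
- apply/forallP/idP => [/(_ true)|h [|]]; rewrite !E; lia.
Qed.

End Outcomes.

(** The values of f and of f after s form the same multiset; both lists are sorted, hence equal.
    Nothing is claimed about s itself, which may permute points with equal values. *)
Lemma monotone_perm (n : nat) (f : 'I_n -> nat) (s : {perm 'I_n}) :
  {homo f : x y / x <= y >-> x <= y} -> {homo f \o s : x y / x <= y >-> x <= y} ->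
  forall x, f (s x) = f x.
Proof.
move=> fm fsm x.
have srt (g : 'I_n -> nat) : {homo g : x y / x <= y >-> x <= y} ->
    sorted leq (map g (enum 'I_n)).
  move=> gm; rewrite sorted_map.
  apply: (@sub_sorted _ (relpre val leq)) => [u v|]; first exact: gm.
  by rewrite -sorted_map val_enum_ord iota_sorted.
have E : map (f \o s) (enum 'I_n) = map f (enum 'I_n).
  apply: (sorted_eq leq_trans anti_leq); [exact: srt|exact: srt|].
  rewrite map_comp; apply: perm_map; apply: uniq_perm.
  - by rewrite map_inj_uniq ?enum_uniq //; exact: perm_inj.
  - exact: enum_uniq.
  - move=> y; rewrite mem_enum; apply/mapP; exists (s^-1 y)%g; first by rewrite mem_enum.
    by rewrite permKV.
by move/eq_in_map: E => E; apply: E; rewrite mem_enum.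
Qed.

Lemma eq_s_count (n : nat) (alpha : 'I_n -> nat) (h g : voting alpha) i (k : 'I_(alpha i).+1) c :
  h =1 g -> s_count h k c = s_count g k c.
Proof. by move=> e; congr #|pred_of_set _|; apply/setP => z; rewrite !inE e. Qed.

Lemma relabel_profileK (n : nat) (alpha : 'I_n -> nat) (rho : labeling alpha) :
  cancel (relabel_profile rho) (relabel_profile (fun i => (rho i)^-1%g)).
Proof. by move=> z; apply/ffunP => i; rewrite !ffunE permK. Qed.

Lemma relabel_profileKV (n : nat) (alpha : 'I_n -> nat) (rho : labeling alpha) :
  cancel (relabel_profile (fun i => (rho i)^-1%g)) (relabel_profile rho).
Proof. by move=> z; apply/ffunP => i; rewrite !ffunE permKV. Qed.

Lemma s_count_relabel (n : nat) (alpha : 'I_n -> nat) (h : voting alpha)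
    (rho : labeling alpha) i (k : 'I_(alpha i).+1) c :
  s_count (relabel h rho) k c = s_count h (rho i k) c.
Proof.
rewrite /s_count -(card_imset _ (can_inj (relabel_profileK rho))).
congr #|pred_of_set _|; apply/setP => z; rewrite inE.
apply/imsetP/andP => [[w]|[/eqP zi cz]].
  by rewrite inE => /andP[/eqP wi cw] ->; rewrite ffunE wi.
exists (relabel_profile (fun i => (rho i)^-1%g) z); last by rewrite relabel_profileKV.
by rewrite inE /relabel relabel_profileKV cz ffunE zi permK eqxx.
Qed.

(* The profile z with coordinate i replaced by k, a number at most alpha i. *)
Definition set_coord (n : nat) (alpha : 'I_n -> nat) (z : profile alpha) (i : 'I_n)
    (k : nat) : profile alpha :=
  [ffun j => inord (if j == i then k else z j)].

Lemma set_coordE (n : nat) (alpha : 'I_n -> nat) (z : profile alpha) i k j :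
  k <= alpha i -> set_coord z i k j = (if j == i then k else z j) :> nat.
Proof.
by move=> lk; rewrite ffunE inordK //; case: eqP => [->//|_]; exact: ltn_ord.
Qed.

Lemma profile_eq (n : nat) (alpha : 'I_n -> nat) (z w : profile alpha) :
  (forall i, z i = w i :> nat) -> z = w.
Proof. by move=> e; apply/ffunP => i; apply: val_inj; exact: e. Qed.

Lemma set_coord_id (n : nat) (alpha : 'I_n -> nat) (z : profile alpha) i :
  set_coord z i (z i) = z.
Proof.
apply: profile_eq => j; rewrite set_coordE; last by rewrite -ltnS ltn_ord.
by case: eqP => [->|].
Qed.

Lemma set_coordC (n : nat) (alpha : 'I_n -> nat) (z : profile alpha) i k l :
  k <= alpha i -> l <= alpha i -> set_coord (set_coord z i k) i l = set_coord z i l.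
Proof.
move=> lk ll; apply: profile_eq => j; rewrite !set_coordE //.
by case: (j =P i).
Qed.

Lemma votes_a_set_coord (n : nat) (alpha : 'I_n -> nat) (z : profile alpha) i k :
  k <= alpha i -> votes_a (set_coord z i k) + z i = votes_a z + k.
Proof.
move=> lk; rewrite /votes_a (bigD1 i) //= [in RHS](bigD1 i) //= set_coordE // eqxx.
rewrite (eq_bigr (fun j => z j : nat)) => [|j /negbTE ji]; last by rewrite set_coordE // ji.
by rewrite -addnA addnC; congr (_ + _); rewrite addnC.
Qed.

(** A plane is indexed by the profiles with coordinate i equal to 0. Different planes of one voter
    thus give subsets of the same set, which can be compared by inclusion. *)
Definition plane_set (n : nat) (alpha : 'I_n -> nat) (h : voting alpha) (i : 'I_n)
    (c : candidate) (k : nat) : {set profile alpha} :=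
  [set z : profile alpha | (z i == ord0) && (c \in h (set_coord z i k))].

Lemma s_countE (n : nat) (alpha : 'I_n -> nat) (h : voting alpha) i
    (k : 'I_(alpha i).+1) c :
  s_count h k c = #|plane_set h i c k|.
Proof.
have lk : k <= alpha i by rewrite -ltnS ltn_ord.
rewrite /s_count /plane_set !cardsE - !sum1_card.
rewrite (reindex_onto (fun z => set_coord z i k) (fun z => set_coord z i 0)) /=; last first.
  by move=> z /andP[/eqP zk _]; rewrite set_coordC // -zk set_coord_id.
apply: eq_bigl => z; rewrite !unfold_in /= set_coordC //.
have -> : set_coord z i k i == k by apply/eqP/val_inj; rewrite /= set_coordE // eqxx.
rewrite andTb andbC; congr (_ && _).
apply/eqP/eqP => [<-|zi]; last by rewrite -[0]/(val (@ord0 (alpha i))) -zi set_coord_id.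
by apply: val_inj; rewrite /= set_coordE // eqxx.
Qed.

Lemma card_plane_const (n : nat) (alpha : 'I_n -> nat) i (k l : 'I_(alpha i).+1) :
  #|[set z : profile alpha | z i == k]| = #|[set z : profile alpha | z i == l]|.
Proof.
(* A whole plane is what [s_count] counts for the correspondence that always elects both candidates,
   so [s_countE] applies. *)
have E (u : 'I_(alpha i).+1) : #|[set z : profile alpha | z i == u]| =
    s_count (fun=> setT : {set candidate}) u true.
  by congr #|pred_of_set _|; apply/setP => z; rewrite !inE andbT.
rewrite !E !s_countE; congr #|pred_of_set _|; apply/setP => z; by rewrite !inE.
Qed.

Lemma s_count_compl (n : nat) (alpha : 'I_n -> nat) (h : voting alpha) i
    (k : 'I_(alpha i).+1) c :
  s_count h k c + #|[set z : profile alpha | (z i == k) && (c \notin h z)]| =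
  #|[set z : profile alpha | z i == k]|.
Proof.
rewrite -(cardsID [set z : profile alpha | c \in h z] [set z : profile alpha | z i == k]).
by congr (_ + _); apply: eq_card => z; rewrite !inE // andbC.
Qed.

(** * Planes and ties in the majority array *)

Section Majority.
Variables (n : nat) (alpha : 'I_n -> nat).
Notation maj := (@majority n alpha).
Implicit Types (z : profile alpha) (i : 'I_n).

Lemma plane_set_a i k l : k <= l -> l <= alpha i ->
  plane_set maj i true k \subset plane_set maj i true l.
Proof.
move=> kl ll; apply/subsetP => z; rewrite !inE => /andP[-> /=].
rewrite !(majorityE _).1 => h.
have := votes_a_set_coord z (leq_trans kl ll); have := votes_a_set_coord z ll; lia.
Qed.

Lemma plane_set_b i k l : k <= l -> l <= alpha i ->
  plane_set maj i false l \subset plane_set maj i false k.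
Proof.
move=> kl ll; apply/subsetP => z; rewrite !inE => /andP[-> /=].
rewrite !(majorityE _).2 => h.
have := votes_a_set_coord z (leq_trans kl ll); have := votes_a_set_coord z ll; lia.
Qed.

Lemma s_count_majority_a i (k l : 'I_(alpha i).+1) :
  k <= l -> s_count maj k true <= s_count maj l true.
Proof. by move=> kl; rewrite !s_countE subset_leq_card ?plane_set_a // -ltnS ltn_ord. Qed.

Lemma s_count_majority_b i (k l : 'I_(alpha i).+1) :
  k <= l -> s_count maj l false <= s_count maj k false.
Proof. by move=> kl; rewrite !s_countE subset_leq_card ?plane_set_b // -ltnS ltn_ord. Qed.

Lemma same_plane i (k l : 'I_(alpha i).+1) z :
  s_count maj k true = s_count maj l true -> s_count maj k false = s_count maj l false ->
  maj (set_coord z i k) = maj (set_coord z i l).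
Proof.
wlog kl : k l / k <= l => [th|ea eb].
  by case: (leqP k l) => [/th//|/ltnW/th h ea eb]; rewrite h.
have ll : l <= alpha i by rewrite -ltnS ltn_ord.
have lk : k <= alpha i by exact: leq_trans kl ll.
rewrite !s_countE in ea eb.
have Ea : plane_set maj i true k = plane_set maj i true l.
  by apply/eqP; rewrite eqEcard plane_set_a //= ea.
have Eb : plane_set maj i false l = plane_set maj i false k.
  by apply/eqP; rewrite eqEcard plane_set_b //= eb.
pose w := set_coord z i 0.
have w0 : w i == ord0 by apply/eqP/val_inj; rewrite /w /= set_coordE // eqxx.
have E u : u <= alpha i -> set_coord z i u = set_coord w i u.
  by move=> lu; rewrite /w set_coordC.
apply/setP => -[]; rewrite !E //.
  by have /setP/(_ w) := Ea; rewrite !inE w0.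
by have /setP/(_ w) := Eb; rewrite !inE w0.
Qed.

(** Cards of the other voters are moved to a one at a time, by induction on t. *)
Lemma exists_votes_a i k t : k <= alpha i ->
  t + alpha i <= sigma alpha -> exists z : profile alpha, z i = k :> nat /\ votes_a z = k + t.
Proof.
move=> lk ht.
have [c [ci ca cs]] : exists c : 'I_n -> nat,
    [/\ c i = k, forall j, c j <= alpha j & \sum_(j < n) c j = k + t].
  elim: t ht => [|t IH] ht.
    exists (fun j => if j == i then k else 0); rewrite eqxx; split=> //.
      by move=> j; case: eqP => [->|].
    by rewrite (bigD1 i) //= eqxx big1 // => j /negbTE->.
  have [|c [ci ca cs]] := IH; first by lia.
  have [j /andP[ji lj]|no] := pickP [pred j | (j != i) && (c j < alpha j)].
    exists (fun x => if x == j then (c j).+1 else c x); split.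
    - by rewrite eq_sym (negbTE ji).
    - by move=> x; case: eqP => [->|_].
    - rewrite (bigD1 j) //= eqxx addnS -cs [in RHS](bigD1 j) //= addSn; congr (_ + _).+1.
      by apply: eq_bigr => x /negbTE->.
  move: ht cs; rewrite /sigma (bigD1 i) //= [X in X = _](bigD1 i) //= ci.
  have : \sum_(j < n | j != i) alpha j <= \sum_(j < n | j != i) c j.
    by apply: leq_sum => j ji; have := no j; rewrite /= ji /=; lia.
  move: (\sum_(j < n | j != i) alpha j) (\sum_(j < n | j != i) c j) => x y h1 h2 h3.
  exfalso; clear -h1 h2 h3; lia.
exists [ffun j => inord (c j)]; split; first by rewrite ffunE inordK ?ci.
by rewrite -cs; apply: eq_bigr => j _; rewrite ffunE inordK // ltnS ca.
Qed.

Lemma s_count_tie i (k l : 'I_(alpha i).+1) : 1 <= alpha i ->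
  ~~ (~~ odd (sigma alpha) && (sigma alpha < 2 * alpha i)) ->
  s_count maj k true = s_count maj l true -> s_count maj k false = s_count maj l false.
Proof.
move=> a1 light ea.
case: (boolP (odd (sigma alpha))) light => [od _|ev /=]; last first.
  rewrite -leqNgt => le.
  wlog kl : k l ea / k < l => [th|].
    case: (ltngtP k l) => [/th->//|/th<-//|/val_inj->//].
  have ll : l <= alpha i by rewrite -ltnS ltn_ord.
  (* The total is [sigma / 2 - 1], one card short of a draw: raising k to l elects a, while k does
     not. This is the pivotal profile; k fits below the total because
     [k < l <= alpha i <= sigma / 2]. *)
  have [z [zk tz]] : exists z : profile alpha, z i = k :> nat /\
      votes_a z = k + ((sigma alpha).-1./2 - k).
    by apply: exists_votes_a; lia.
  have : set_coord z i 0 \in plane_set maj i true l.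
    rewrite inE set_coordC // (majorityE _).1.
    have -> : set_coord z i 0 i == ord0 by apply/eqP/val_inj; rewrite /= set_coordE // eqxx.
    have := votes_a_set_coord z ll; lia.
  have -> : plane_set maj i true l = plane_set maj i true k.
    rewrite !s_countE in ea.
    by apply/esym/eqP; rewrite eqEcard (plane_set_a (ltnW kl) ll) ea leqnn.
  rewrite inE set_coordC // ?(majorityE _).1; last by lia.
  rewrite -zk set_coord_id; lia.
(* Now sigma is odd, so no outcome is a draw and b wins exactly where a does not. *)
have E (u : 'I_(alpha i).+1) : s_count maj u false =
    #|[set z : profile alpha | (z i == u) && (true \notin maj z)]|.
  congr #|pred_of_set _|; apply/setP => z; rewrite !inE (majorityE z).1 (majorityE z).2.
  congr (_ && _); lia.
have := s_count_compl maj k true; have := s_count_compl maj l true.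
by rewrite -!E (card_plane_const k l) ea; lia.
Qed.
End Majority.

(** * Characterization of DAV correspondences *)

Section DAV.
Variables (n : nat) (alpha : 'I_n -> nat).
Notation maj := (@majority n alpha).
Implicit Types (h : voting alpha) (rho tau pi : labeling alpha) (z : profile alpha).

Lemma is_DAVE h : is_DAV h <-> exists pi, forall z, h z = maj (relabel_profile pi z).
Proof.
split=> -[pi e]; exists pi => z; rewrite e -AM_majority; congr AM;
  by apply: eq_bigr => i _; rewrite ffunE.
Qed.

Lemma DAV_of_majority h rho : (forall z, relabel h rho z = maj z) -> is_DAV h.
Proof.
move=> e; apply/is_DAVE; exists (fun i => (rho i)^-1%g) => z.
by rewrite -e /relabel relabel_profileKV.
Qed.

Lemma relabel_majority_sorted tau : (forall i, 1 <= alpha i) ->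
  a_monotone (relabel maj tau) -> ties_ordered (relabel maj tau) ->
  forall z, relabel maj tau z = maj z.
Proof.
move=> a1 mono ties.
have key i (k : 'I_(alpha i).+1) :
    s_count maj (tau i k) true = s_count maj k true /\
    s_count maj (tau i k) false = s_count maj k false.
  pose M := #|{: profile alpha}|.+1.
  have eM (u : 'I_(alpha i).+1) : s_count maj u false < M by rewrite ltnS max_card.
  (* The lexicographic order, by increasing count of a and then decreasing count of b, is encoded in
     one number so that [monotone_perm] applies. M exceeds all counts, so both can be read off again
     as quotient and remainder modulo M. *)
  pose f (u : 'I_(alpha i).+1) := s_count maj u true * M + (M - (s_count maj u false).+1).
  have mulM x y : x < y -> x * M + M <= y * M.
    by move=> lt; rewrite -mulSnr leq_mul2r lt orbT.
  have fE : f (tau i k) = f k.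
    apply: (monotone_perm (f := f)) => u v uv; rewrite /f /=.
    - have := s_count_majority_b uv; have := s_count_majority_a uv.
      rewrite leq_eqVlt => /orP[/eqP->|/mulM]; lia.
    - have := mono _ _ _ uv; rewrite !s_count_relabel leq_eqVlt => /orP[/eqP e|/mulM]; last by lia.
      suff : s_count maj (tau i v) false <= s_count maj (tau i u) false by rewrite e; lia.
      (* With equal counts of a, a voter with more than half of an even sigma is covered by
         [ties_ordered]; for all others [s_count_tie] gives equal counts of b. *)
      case: (boolP (~~ odd (sigma alpha) && (sigma alpha < 2 * alpha i))) => [/andP[c1 c2]|light].
        by have := ties i c1 c2 _ _ uv; rewrite !s_count_relabel; apply.
      by rewrite (s_count_tie (a1 i) light e).
  have := congr1 (divn ^~ M) fE; have := congr1 (modn ^~ M) fE; rewrite /f /=.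
  rewrite !modnMDl !divnMDl // !modn_small ?divn_small ?addn0; try by lia.
  have := eM (tau i k); have := eM k; lia.
(* [w j] has its first j coordinates relabeled. From [w j] to [w j.+1] one plane is replaced by an
   equal one, so the outcome does not change. *)
move=> z; pose w (j : nat) : profile alpha := [ffun i : 'I_n => if i < j then tau i (z i) else z i].
have w0 : w 0 = z by apply/ffunP => i; rewrite ffunE.
have wn : w n = relabel_profile tau z by apply/ffunP => i; rewrite !ffunE ltn_ord.
rewrite /relabel -wn -[in RHS]w0.
suff wS j : j <= n -> maj (w j) = maj (w 0) by exact: wS.
elim: j => // j IH lj; rewrite -IH; last exact: ltnW.
pose i := Ordinal lj.
have wi : w j i = z i by rewrite ffunE /= ltnn.
have leu (u : 'I_(alpha i).+1) : u <= alpha i by rewrite -ltnS ltn_ord.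
have -> : w j.+1 = set_coord (w j) i (tau i (z i)).
  apply: profile_eq => x; rewrite set_coordE //; case: (x =P i) => [->|ne].
    by rewrite ffunE /= ltnSn.
  have {}ne : (x : nat) != j by apply: contra_not_neq ne => e; exact: val_inj.
  by rewrite !ffunE ltnS leq_eqVlt (negbTE ne).
have [ka kb] := key i (z i).
by rewrite (same_plane _ ka kb) -wi set_coord_id.
Qed.

Lemma DAV_iff_sorted h rho : (forall i, 1 <= alpha i) ->
  a_monotone (relabel h rho) -> ties_ordered (relabel h rho) ->
  (is_DAV h <-> forall z, relabel h rho z = maj z).
Proof.
move=> a1 mono ties; split; last exact: DAV_of_majority.
case/is_DAVE => pi e.
(* Composition of permutations acts from left to right: [tau i] applies [rho i] first, then
   [pi i]. *)
pose tau : labeling alpha := fun i => (rho i * pi i)%g.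
have E z : relabel h rho z = relabel maj tau z.
  rewrite /relabel e; congr maj.
  by apply/ffunP => i; rewrite !ffunE permM.
have S i k c : @s_count n alpha (relabel h rho) i k c = s_count (relabel maj tau) k c.
  exact: eq_s_count.
move=> z; rewrite E; apply: relabel_majority_sorted => //.
- by move=> i k l kl; rewrite -!S; exact: mono.
- by move=> i od he k l kl; rewrite -!S; exact: ties.
Qed.

(** Relabeling by the inverse of a DAV labeling gives the majority array itself, whose counts of a
    are monotone. *)
Lemma DAV_iff_exists h :
  is_DAV h <-> exists rho, a_monotone (relabel h rho) /\ forall z, relabel h rho z = maj z.
Proof.
split=> [/is_DAVE[pi e]|[rho [_ e]]]; last exact: DAV_of_majority e.
exists (fun i => (pi i)^-1%g).
have E z : relabel h (fun i => (pi i)^-1%g) z = maj z.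
  by rewrite /relabel e relabel_profileKV.
split=> // i k l kl; rewrite !(eq_s_count _ _ E).
exact: s_count_majority_a.
Qed.
End DAV.

(** * Weakest preconditions for programs *)

(* Q is given the total time, t being the time spent before p starts. *)
Definition wp (W : nat) (p : prog) (Q : state -> nat -> Prop) (s : state)
    (t : nat) : Prop :=
  exists t' s', exec W p s t' s' /\ Q s' (t + t').

Lemma wp_seq W p1 p2 Q s (t : nat) :
  wp W p1 (wp W p2 Q) s t -> wp W (Seq p1 p2) Q s t.
Proof.
case=> t1 [s1] [e1] [t2] [s2] [e2 q]; exists (t1 + t2), s2.
by split; [exact: ExecSeq e1 e2|rewrite addnA].
Qed.

Lemma wp_skip W (Q : state -> nat -> Prop) s (t : nat) : Q s (t + 1) -> wp W Skip Q s t.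
Proof. by move=> q; exists 1, s; split=> //; exact: ExecSkip. Qed.

Lemma wp_assign W x e (Q : state -> nat -> Prop) s (t : nat) :
  fits W s e ->
  Q (State (upd (regs s) x (eval s e)) (mem s)) (t + (cost e).+1) ->
  wp W (Assign x e) Q s t.
Proof. by move=> f q; do 2!eexists; split; [exact: ExecAssign|]. Qed.

Lemma wp_write W e1 e2 (Q : state -> nat -> Prop) s (t : nat) :
  fits W s e1 -> fits W s e2 ->
  Q (State (regs s) (upd (mem s) (eval s e1) (eval s e2)))
    (t + (cost e1 + cost e2).+1) ->
  wp W (Write e1 e2) Q s t.
Proof. by move=> f1 f2 q; do 2!eexists; split; [exact: ExecWrite|]. Qed.

Lemma wp_if W e p1 p2 Q s (t : nat) :
  fits W s e ->
  (eval s e != 0 -> wp W p1 Q s (t + (cost e).+1)) ->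
  (eval s e == 0 -> wp W p2 Q s (t + (cost e).+1)) ->
  wp W (If e p1 p2) Q s t.
Proof.
move=> f q1 q2; case: (boolP (eval s e == 0)) => [c|c].
- have [t' [s' [e' q]]] := q2 c; exists (cost e + t').+1, s'.
  by split; [exact: ExecIfFalse|rewrite -addSn addnA].
- have [t' [s' [e' q]]] := q1 c; exists (cost e + t').+1, s'.
  by split; [exact: ExecIfTrue|rewrite -addSn addnA].
Qed.

(** [I k] is an invariant indexed by a decreasing measure k. As it also speaks of the elapsed time,
    the same rule yields termination, correctness and cost. *)
Lemma wp_while W e p (I : nat -> state -> nat -> Prop) k (Q : state -> nat -> Prop) s (t : nat) :
  I k s t ->
  (forall k s t, I k s t -> fits W s e) ->
  (forall k s t, I k s t -> eval s e == 0 -> Q s (t + (cost e).+1)) ->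
  (forall k s t, I k s t -> eval s e != 0 ->
     wp W p (fun s' t' => exists2 k', k' < k & I k' s' t') s (t + (cost e).+1)) ->
  wp W (While e p) Q s t.
Proof.
move=> Ik hf hq hb; elim/ltn_ind: k s t Ik => k IH s t Ik.
case: (boolP (eval s e == 0)) => [c|c].
- exists (cost e).+1, s; split; last exact: (hq _ _ _ Ik c).
  by apply: ExecWhileFalse => //; exact: hf Ik.
- have [t1 [s1 [e1 [k' ltk Ik']]]] := hb _ _ _ Ik c.
  have [t2 [s2 [e2 q]]] := IH _ ltk _ _ Ik'.
  exists (cost e + t1 + t2).+1, s2; split.
    exact: ExecWhileTrue (hf _ _ _ Ik) c e1 e2.
  by rewrite -addSn -addSn !addnA.
Qed.

(** The measure is the value of the register tested by the loop; 2 is the cost of one such test. *)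
Lemma wp_countdown W r p (I : nat -> state -> nat -> Prop) k0
    (Q : state -> nat -> Prop) s (t : nat) :
  k0 <= W -> regs s r = k0 -> I k0 s t ->
  (forall s t, regs s r = 0 -> I 0 s t -> Q s (t + 2)) ->
  (forall k s t, k < k0 -> regs s r = k.+1 -> I k.+1 s t ->
     wp W p (fun s' t' => regs s' r = k /\ I k s' t') s (t + 2)) ->
  wp W (While (Reg r) p) Q s t.
Proof.
move=> lekW rk Ik hq hb.
apply: (@wp_while _ _ _
  (fun k s t => [/\ k <= k0, regs s r = k & I k s t]) k0) => //=.
- by move=> k s' t' [lek -> _]; rewrite (leq_trans lek lekW).
- by move=> k s' t' [lek rk' Ik'] /eqP r0; apply: hq => //; rewrite -r0 rk'.
- move=> k s' t' [lek rk' Ik'] rn0; case: k lek rk' Ik' => [|k] lek rk' Ik'.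
    by rewrite rk' in rn0.
  have [t1 [s1 [e1 [r1 I1]]]] := hb _ _ _ lek rk' Ik'.
  by exists t1, s1; split=> //; exists k => //; split=> //; exact: ltnW.
Qed.

(* Memory is cut into regions of K = 4 N cells.  Registers 4 to 7 hold K, N, n
   and the number of planes.  The regions are: 0 the input; 1 the strides; 2 the
   offsets; 3 and 4 the voter and the index of each plane; 6 and 8 the partial
   sums of the array; 7 and 9 the counts of the planes; 10 and 11 the heads and
   the links of the buckets; 12 to 15 the successive orders of the planes; 16 the
   labeling; 17 its products with the strides; 18 and 19 the addresses and the
   numbers of cards for a of the relabeled cells; 20 the relabeled array. *)
Definition At (g : nat) (e : expr) : expr := Op Defs.Add (Op Defs.Mul (Const g) (Reg 4)) e.

Lemma region_eq K g g' y y' :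
  y < K -> y' < K -> (g * K + y == g' * K + y') = (g == g') && (y == y').
Proof.
move=> ly ly'; apply/eqP/andP=> [h|[/eqP-> /eqP->] //].
have := congr1 (divn^~ K) h; have := congr1 (modn^~ K) h.
rewrite /= !modnMDl !modn_small // => ->.
have K0 : 0 < K by lia.
by rewrite !divnMDl // !divn_small // !addn0 => ->.
Qed.

(** The new memory is described by pairs of a region and a position, which determine the address
    uniquely by [region_eq]; aliasing between tables is decided by comparing region numbers.
    Computing the address and writing cost 5 besides the two expressions. *)
Lemma wp_write_at W K g e1 e2 (Q : state -> nat -> Prop) s (t : nat) :
  regs s 4 = K -> eval s e1 < K ->
  g <= W -> K <= W -> g * K + eval s e1 <= W -> fits W s e1 -> fits W s e2 ->
  (forall m', (forall g' y, y < K -> m' (g' * K + y) =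
       if (g' == g) && (y == eval s e1) then eval s e2 else mem s (g' * K + y)) ->
     Q (State (regs s) m') (t + (cost e1 + cost e2 + 5))) ->
  wp W (Write (At g e1) e2) Q s t.
Proof.
move=> rK lt1 lgW lKW leW f1 f2 q; apply: wp_write => //.
  by rewrite /= rK f1 leW lgW lKW (leq_trans _ leW) // leq_addr.
rewrite /= rK (_ : _.+1 = cost e1 + cost e2 + 5); last by lia.
by apply: q => g' y ly; rewrite /upd region_eq.
Qed.

Declare Scope prog_scope.
Delimit Scope prog_scope with prog.
Notation "e1 \+ e2" := (Op Defs.Add e1 e2) : prog_scope.
Notation "e1 \- e2" := (Op Defs.Sub e1 e2) : prog_scope.
Notation "e1 \* e2" := (Op Defs.Mul e1 e2) : prog_scope.
Notation "x ::= e" := (Assign x e) (at level 70, no associativity) : prog_scope.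
Notation "p ;; q" := (Seq p q) (at level 90, right associativity) : prog_scope.
Notation "$ x" := (Reg x) (at level 9, format "$ x") : prog_scope.
Notation "# x" := (Const x) (at level 9, format "# x") : prog_scope.
Open Scope prog_scope.

(** Registers below 10 hold results and global sizes, those from 10 on mostly the state of outer
    loops, those from 20 on mostly that of inner loops. A single bound then serves as frame
    condition. *)
Definition same_regs (b : nat) (s s' : state) : Prop :=
  forall r, r < b -> regs s' r = regs s r.

Lemma same_regs_refl b s : same_regs b s s.
Proof. by []. Qed.

Lemma same_regs_trans b b1 b2 s1 s2 s3 : b <= b1 -> b <= b2 ->
  same_regs b1 s1 s2 -> same_regs b2 s2 s3 -> same_regs b s1 s3.
Proof.
by move=> l1 l2 h1 h2 r lr; rewrite h2 ?h1 // (leq_trans lr).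
Qed.

Lemma same_regs_upd b s f r v m :
  b <= r -> same_regs b s (State f m) -> same_regs b s (State (upd f r v) m).
Proof. by move=> ler h x lx; rewrite /= /upd -h // ltn_eqF // (leq_trans lx). Qed.


Ltac frame := repeat (apply: same_regs_upd => //).

(** * Strides and offsets *)

(** [m j] stands for the number $\alpha_j+1$ of planes of voter j, as a function on all natural
    numbers, which keeps dependent types out of the program proofs. [stride m n 0] is the number N
    of profiles, [stride m n j.+1] the weight of coordinate j in an address, and [offset m n] the
    number of planes. *)
Definition stride (m : nat -> nat) (n j : nat) : nat := \prod_(j <= i < n) m i.
Definition offset (m : nat -> nat) (j : nat) : nat := \sum_(0 <= i < j) m i.

Lemma stride_last m n : stride m n n = 1.
Proof. by rewrite /stride big_geq. Qed.

Lemma strideS m n j : j < n -> stride m n j = m j * stride m n j.+1.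
Proof. by move=> lj; rewrite /stride big_ltn. Qed.

Lemma offset0 m : offset m 0 = 0.
Proof. by rewrite /offset big_geq. Qed.

Lemma offsetS m j : offset m j.+1 = offset m j + m j.
Proof. by rewrite /offset big_nat_recr. Qed.

Lemma offset_mono m i j : i <= j -> offset m i <= offset m j.
Proof. by move=> h; rewrite /offset (big_cat_nat _ h) ?leq_addr. Qed.

Lemma stride_gt0 m n j : (forall i, i < n -> 2 <= m i) -> 0 < stride m n j.
Proof.
move=> h; rewrite /stride big_nat_cond prodn_cond_gt0 // => i.
by case/andP=> /andP[_ /h/ltnW].
Qed.

Lemma stride_dvd m n i j : i <= j -> j <= n -> stride m n j %| stride m n i.
Proof. by move=> lij ljn; rewrite {2}/stride (big_cat_nat lij ljn) /= dvdn_mull. Qed.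

Lemma stride_le m n j : (forall i, i < n -> 2 <= m i) -> j <= n ->
  stride m n j <= stride m n 0.
Proof. by move=> hm lj; rewrite dvdn_leq ?stride_gt0 // stride_dvd. Qed.

Lemma stride_gt m n j : (forall i, i < n -> 2 <= m i) -> j <= n ->
  n - j < stride m n j.
Proof.
move=> h; elim: n => [|n IH] in h *; first by case: j => // _; rewrite stride_last.
rewrite leq_eqVlt => /orP[/eqP->|lj]; first by rewrite stride_last subnn.
have le : j <= n by [].
rewrite /stride big_nat_recr //= -/(stride m n j).
have := IH (fun i li => h i (ltnW li)) le; have := h n (ltnSn n); nia.
Qed.

(** By $p+q\le pq$ for $p,q\ge 2$. Hence tables of planes fit into N cells, voter numbers and plane
    counts can share the same N + 1 buckets, and a pass over all planes takes O(N) time. *)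
Lemma offset_le m n j : (forall i, i < n -> 2 <= m i) -> j <= n -> 0 < j ->
  offset m j <= stride m j 0.
Proof.
move=> h; elim: j => // j IH lj _.
rewrite offsetS /stride big_nat_recr //= -/(stride m j 0).
case: j => [|j] in IH lj *; first by rewrite /stride big_geq // offset0 mul1n.
have := IH (ltnW lj) isT; have := h _ lj.
have := @stride_gt m j.+1 0 (fun i li => h i (leq_trans li (ltnW lj))) isT.
nia.
Qed.

(** Regions have numbers below 30, so their addresses stay below [31 * K]. With K = 4 N a region has
    room for the input with its header, and for the 2 N cells of partial sums. *)
Definition layout (W K n : nat) (m : nat -> nat) : Prop :=
  [/\ K = 4 * stride m n 0, 31 * K <= W, 2 <= n & forall j, j < n -> 2 <= m j].

Lemma layout_bounds W K n m : layout W K n m ->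
  [/\ K = 4 * stride m n 0, 31 * K <= W, 4 <= stride m n 0,
      2 <= n < stride m n 0 & offset m n <= stride m n 0].
Proof.
move=> [-> hW hn hm]; split=> //.
- rewrite (strideS m (ltnW hn)) (strideS m hn) mulnA.
  have := stride_gt0 2 hm; have := hm _ hn; have := hm _ (ltnW hn); nia.
- by have := stride_gt hm (leq0n n); rewrite subn0 hn.
- by apply: offset_le hm _ _ => //; exact: ltnW.
Qed.

Lemma sum_fiber N q (a : nat -> nat) (P : pred nat) : 0 < q ->
  \sum_(0 <= z < q | P z) \sum_(0 <= x < N | x %% q == z) a x =
  \sum_(0 <= x < N | P (x %% q)) a x.
Proof.
move=> q0; rewrite (exchange_big_dep (fun x => P (x %% q))) /=; last first.
  by move=> z x Pz /eqP->.
apply: eq_bigr => x Px.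
rewrite (eq_bigl (fun z => z == x %% q)) => [|z]; last first.
  by rewrite eq_sym; case: eqP => [->|_]; rewrite ?Px ?andbF.
by rewrite big_nat1_eq ltn_mod q0.
Qed.

(** * Counting the planes *)

(* Registers 20, 21 and 22 hold x, x mod q and o + x div q, q being in register 12. *)
Definition divmod_pred : prog :=
  20 ::= $20 \- #1;;
  If $21 (21 ::= $21 \- #1) (21 ::= $12 \- #1;; 22 ::= $22 \- #1).

(** The machine cannot divide, but when x decreases by 1 its quotient and remainder by q change by
    at most a borrow, at constant cost. *)
Lemma wp_divmod_pred W m q o x k r (Q : state -> nat -> Prop) s (t : nat) :
  0 < W -> m * q <= W -> o + m <= W -> q <= W ->
  regs s 12 = q -> regs s 20 = x.+1 -> regs s 21 = r -> regs s 22 = o + k ->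
  x.+1 = k * q + r -> r < q -> k <= m -> x < m * q ->
  (forall s' t' k' r', same_regs 20 s s' -> mem s' = mem s -> regs s' 20 = x ->
     regs s' 21 = r' -> regs s' 22 = o + k' -> x = k' * q + r' -> r' < q -> k' < m ->
     t' <= t + 20 -> Q s' t') ->
  wp W divmod_pred Q s t.
Proof.
move=> W0 hmq hom hq r12 r20 r21 r22 xE ltr lek ltx hQ.
have q0 : 0 < q by lia.
apply: wp_seq; apply: wp_assign => /=; first by lia.
apply: wp_if => /=; rewrite /upd /= ?r21; first by lia.
- move=> r0; apply: wp_assign => /=; first by rewrite /upd /= r21; lia.
  have ltk : k < m by rewrite -(ltn_pmul2r q0); lia.
  by apply: (hQ _ _ k r.-1); rewrite /upd //= ?r20 ?r21; try lia; frame.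
- move=> /eqP r0; case: k lek r22 xE => [|k] lek r22 xE; first by lia.
  rewrite mulSn in xE.
  apply: wp_seq; apply: wp_assign => /=; first by rewrite /upd /= r12; lia.
  apply: wp_assign => /=; first by rewrite /upd /= r22; lia.
  by apply: (hQ _ _ k q.-1); rewrite /upd //= ?r20 ?r22 ?r12; try lia; frame.
Qed.

(** The array over voters j, j+1, ... starts at register 10, the one over j+1, ... at register 13.
    Cell x contributes to cell x mod q of the latter and to the count of plane x div q of voter
    j. *)
Definition marginalize (gA gS : nat) : prog :=
  While $20 (
    divmod_pred;;
    23 ::= Read (At gA ($10 \+ $20));;
    Write (At gA ($13 \+ $21)) (Read (At gA ($13 \+ $21)) \+ $23);;
    Write (At gS $22) (Read (At gS $22) \+ $23)).

Lemma wp_marginalize W K N gA gS m q b b2 o (A : nat -> nat)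
    (Q : state -> nat -> Prop) s (t : nat) :
  regs s 4 = K -> regs s 10 = b -> regs s 12 = q -> regs s 13 = b2 ->
  regs s 20 = m * q -> regs s 21 = 0 -> regs s 22 = o + m -> 
  gA < 30 -> gS < 30 -> gA != gS -> 31 * K <= W -> 0 < K -> N <= K ->
  0 < q -> b + m * q <= b2 -> b2 + q <= K -> o + m <= K ->
  (forall y, y < m * q -> mem s (gA * K + (b + y)) = A y) ->
  \sum_(0 <= y < m * q) A y <= N ->
  (forall y, y < q -> mem s (gA * K + (b2 + y)) = 0) ->
  (forall k, k < m -> mem s (gS * K + (o + k)) = 0) ->
  (forall s' t', same_regs 20 s s' ->
     (forall g y, y < K -> mem s' (g * K + y) = mem s (g * K + y)
        + \sum_(0 <= z < m * q | (g == gA) && (y == b2 + z %% q)) A z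
        + \sum_(0 <= z < m * q | (g == gS) && (y == o + z %/ q)) A z) ->
     t' <= t + 100 * (m * q) + 2 -> Q s' t') ->
  wp W (marginalize gA gS) Q s t.
Proof.
move=> R4 R10 R12 R13 R20 R21 R22 hgA hgS neg hW hK hN q0 hb hb2 ho hA sA zA zS hQ.
(* [F x] is the memory once the cells from x upwards have been distributed, the loop counting
   down. *)
pose F x (g y : nat) := mem s (g * K + y)
        + \sum_(x <= z < m * q | (g == gA) && (y == b2 + z %% q)) A z
        + \sum_(x <= z < m * q | (g == gS) && (y == o + z %/ q)) A z.
pose I x s' t' := same_regs 20 s s' /\ (exists k r, [/\ regs s' 21 = r, regs s' 22 = o + k,
   x = k * q + r, r < q & k <= m]) /\
   (forall g y, y < K -> mem s' (g * K + y) = F x g y) /\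
   t' + 100 * x <= t + 100 * (m * q).
apply: (@wp_countdown _ _ _ I (m * q)) => //.
- lia.
- split; first exact: same_regs_refl.
  split; first by exists m, 0; rewrite R21 R22 addn0.
  by split=> // g y ly; rewrite /F !big_geq // !addn0.
- move=> s' t' r20 [fr [_ [hm ht]]]; apply: hQ => //; lia.
move=> x s' t' ltx r20 [fr [[k [r [r21 r22 xE ltr lek]]] [hm ht]]].
apply: wp_seq; apply: (@wp_divmod_pred _ m q o x k r) => //; try lia.
  by rewrite fr.
move=> s1 t1 k1 r1 fr2 ms1 r20' r21' r22' xE' ltr1 ltk1 ht1.
have fr1 : same_regs 20 s s1 by exact: same_regs_trans fr fr2.
move: hm; rewrite -ms1 => {ms1}hm.
have [e4 e10 e12 e13] : [/\ regs s1 4 = K, regs s1 10 = b, regs s1 12 = q & regs s1 13 = b2].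
  by split; rewrite fr1.
(* The source block is intact: within region [gA] only cells from [b2] on are written, and these lie
   above it. *)
have AE y : y < m * q -> mem s1 (gA * K + (b + y)) = A y.
  move=> ly; rewrite hm /F; last by lia.
  rewrite hA // !big_pred0 ?addn0 // => z; first by rewrite (negbTE neg).
  by apply/negP; lia.
(* All partial sums are at most the total of the array, hence at most N, which keeps the additions
   within the word bound. *)
have sub P : \sum_(x.+1 <= z < m * q | P z) A z <= N.
  apply: leq_trans sA; rewrite [X in _ <= X](big_cat_nat _ (n := x.+1)) //=.
  apply: leq_trans (leq_addl _ _).
  by rewrite big_mkcond; apply: leq_sum => z _; case: ifP.
have Ax : A x <= N.
  apply: leq_trans sA; rewrite (big_cat_nat _ (n := x)) //=; last exact: ltnW.
  by rewrite [X in _ + X]big_ltn //; lia.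
have gSA : gS == gA = false by rewrite eq_sym; exact: negbTE.
have gS1 : mem s1 (gS * K + (o + k1)) <= N.
  rewrite hm /F ?zS //; last by lia.
  by rewrite gSA big_pred0 // !add0n sub.
have gA1 : mem s1 (gA * K + (b2 + r1)) <= N.
  rewrite hm /F ?zA //; last by lia.
  by rewrite (negbTE neg) [X in _ + X]big_pred0 // addn0 !add0n sub.
have lgA : gA * K <= 30 * K by rewrite leq_mul2r; lia.
have lgS : gS * K <= 30 * K by rewrite leq_mul2r; lia.
apply: wp_seq; apply: wp_assign => /=.
  by rewrite e4 e10 r20' AE //; lia.
rewrite e4 e10 r20' AE //.
apply: wp_seq; apply: (@wp_write_at _ K); rewrite /upd /= ?e4 ?e13 ?r21' //; try lia.
move=> m1 hm1.
apply: (@wp_write_at _ K); rewrite /upd /= ?e4 ?r22' //; try lia.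
  by rewrite hm1 ?gSA //=; lia.
move=> m2 hm2; split; first by rewrite /upd /=.
split; first by frame.
split; first by exists k1, r1; rewrite /upd /=; split => //; exact: ltnW.
split; last by lia.
move=> g y ly /=; rewrite hm2 // !hm1 //; try lia.
have xd : x %/ q = k1 by rewrite xE' divnMDl // divn_small // addn0.
have xm : x %% q = r1 by rewrite xE' modnMDl modn_small.
rewrite [RHS]/F big_ltn_cond // [X in _ = _ + _ + X]big_ltn_cond // xd xm.
rewrite gSA /=.
case: (boolP ((g == gA) && _)) => [/andP[/eqP-> /eqP->]|c1].
  rewrite (negbTE neg) /= hm; last by lia.
  by rewrite /F (negbTE neg) /= addnAC [A x + _]addnC !addnA.
case: (boolP ((g == gS) && _)) => [/andP[/eqP-> /eqP->]|c2].
  rewrite hm; last by lia.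
  by rewrite /F [A x + _]addnC !addnA.
by rewrite hm.
Qed.

Definition globals (K n : nat) (m : nat -> nat) (s : state) : Prop :=
  [/\ regs s 4 = K, regs s 5 = stride m n 0, regs s 6 = n & regs s 7 = offset m n].

Definition tables (K n : nat) (m : nat -> nat) (s : state) : Prop :=
  (forall j, j <= n -> mem s (1 * K + j) = stride m n j) /\
  (forall j, j <= n -> mem s (2 * K + j) = offset m j).

Lemma globals_same b K n m s s' :
  8 <= b -> same_regs b s s' -> globals K n m s -> globals K n m s'.
Proof. by move=> hb h [r4 r5 r6 r7]; split; rewrite h //; lia. Qed.

Definition fill (gA : nat) (be : expr) : prog :=
  20 ::= $5;;
  While $20 (
    20 ::= $20 \- #1;;
    21 ::= Read ($6 \+ #1 \+ $20);;
    Write (At gA $20) be).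

Definition computes_bit (W : nat) (be : expr) (bit : nat -> nat) : Prop :=
  forall s, regs s 21 <= 3 -> [/\ fits W s be, eval s be = bit (regs s 21) & cost be <= 20].

Lemma wp_fill W K n m gA be bit H (Q : state -> nat -> Prop) s (t : nat) :
  layout W K n m -> globals K n m s -> 0 < gA < 30 -> computes_bit W be bit ->
  (forall x, x < stride m n 0 -> mem s (n + 1 + x) = H x /\ H x <= 3) ->
  (forall s' t', same_regs 20 s s' ->
     (forall g y, y < K -> mem s' (g * K + y) =
        if (g == gA) && (y < stride m n 0) then bit (H y) else mem s (g * K + y)) ->
     t' <= t + 100 * stride m n 0 + 100 -> Q s' t') ->
  wp W (fill gA be) Q s t.
Proof.
move=> lay [r4 r5 r6 r7] /andP[gA0 gA30] hbe hH hQ.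
have [KE hW N4 /andP[n2 nN] TN] := layout_bounds lay.
set N := stride m n 0 in KE hW N4 nN TN hH hQ r5 *.
have lgA : gA * K <= 30 * K by rewrite leq_mul2r; lia.
pose I x s' t' := [/\ same_regs 20 s s',
   (forall g y, y < K -> mem s' (g * K + y) =
        if (g == gA) && (x <= y < N) then bit (H y) else mem s (g * K + y)) &
   t' + 100 * x <= t + 100 * N + 10].
apply: wp_seq; apply: wp_assign => /=; first by lia.
apply: (@wp_countdown _ _ _ I N); rewrite /upd //=; first by lia.
- split; [by frame| |by lia].
  by move=> g y ly /=; case: ifP => //; lia.
- move=> s' t' r20 [fr hm ht]; apply: hQ => //; lia.
move=> x s' t' ltx r20 [fr hm ht].
have e4 : regs s' 4 = K by rewrite fr.
have e6 : regs s' 6 = n by rewrite fr.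
have [hx hx3] := hH _ ltx.
(* The input is read as region 0, which [0 < gA] protects from being overwritten. *)
have hx' : mem s' (n + 1 + x) = H x.
  by rewrite -[n + 1 + x]/(0 * K + (n + 1 + x)) hm ?hx; last lia; rewrite (ltn_eqF gA0).
apply: wp_seq; apply: wp_assign => /=; first by lia.
apply: wp_seq; apply: wp_assign => /=.
  by rewrite /upd /= r20 e6 subn1 /= hx'; lia.
rewrite /upd /= r20 e6 subn1 /= hx'.
set s1 := State _ _.
have [f ev co] := hbe s1 hx3.
apply: (@wp_write_at _ K) => //=; rewrite ?ev; try lia.
move=> m' hm'; split=> //=; split.
- by frame.
- move=> g y ly /=; rewrite hm' // hm //.
  case: (g =P gA) => [->|//] /=.
  case: (y =P x) => [->|ne]; first by rewrite leqnn ltx.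
  by case: ifP; case: ifP => //; lia.
- by lia.
Qed.

(** Coordinate j of the profile at address x: the remainder discards the voters before j, the
    quotient those after j. *)
Definition digit (m : nat -> nat) (n j x : nat) : nat :=
  (x %% stride m n j) %/ stride m n j.+1.

Definition plane_sum (m : nat -> nat) (n : nat) (a : nat -> nat) (j k : nat) : nat :=
  \sum_(0 <= x < stride m n 0 | digit m n j x == k) a x.

(** This is the array a summed over the voters before j; y is the address formed by the remaining
    coordinates. *)
Definition residue_sum (m : nat -> nat) (n : nat) (a : nat -> nat) (j y : nat) : nat :=
  \sum_(0 <= x < stride m n 0 | x %% stride m n j == y) a x.

Lemma residue_sum0 m n a y : y < stride m n 0 -> residue_sum m n a 0 y = a y.
Proof.
move=> ly; rewrite /residue_sum big_nat_cond.
rewrite (eq_bigl (fun x => (0 <= x < stride m n 0) && (x == y))) => [|x]; last first.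
  by case: (ltnP x) => [lx|]; rewrite ?andbF //= modn_small.
by rewrite -big_nat_cond big_nat1_eq ly.
Qed.

(** One round of [marginalize] sums out voter j: as stride j+1 divides stride j, reducing modulo the
    first after the second is reducing modulo the first. *)
Lemma residue_sumS m n a j y : (forall i, i < n -> 2 <= m i) -> j < n ->
  \sum_(0 <= z < stride m n j | y == z %% stride m n j.+1) residue_sum m n a j z =
  residue_sum m n a j.+1 y.
Proof.
move=> hm lj; rewrite /residue_sum sum_fiber; last exact: stride_gt0.
by apply: eq_bigl => x; rewrite modn_dvdm 1?eq_sym // stride_dvd.
Qed.

Lemma plane_sumE m n a j k : (forall i, i < n -> 2 <= m i) ->
  \sum_(0 <= z < stride m n j | k == z %/ stride m n j.+1) residue_sum m n a j z =
  plane_sum m n a j k.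
Proof.
move=> hm; rewrite /residue_sum sum_fiber; last exact: stride_gt0.
by apply: eq_bigl => x; rewrite eq_sym.
Qed.

Lemma sum_residue_sum m n a j : (forall i, i < n -> 2 <= m i) ->
  \sum_(0 <= z < stride m n j) residue_sum m n a j z = \sum_(0 <= x < stride m n 0) a x.
Proof. by move=> hm; rewrite (sum_fiber _ _ xpredT) //; exact: stride_gt0. Qed.

Definition count_planes (gA gS : nat) (be : expr) : prog :=
  fill gA be;;
  10 ::= #0;; 11 ::= #0;; 14 ::= $6;;
  While $14 (
    14 ::= $14 \- #1;;
    20 ::= Read (At 1 $11);;
    13 ::= $10 \+ $20;;
    11 ::= $11 \+ #1;;
    12 ::= Read (At 1 $11);;
    21 ::= #0;;
    22 ::= Read (At 2 $11);;
    marginalize gA gS;;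
    10 ::= $13).

Lemma wp_count_planes W K n m gA gS be bit H (Q : state -> nat -> Prop) s (t : nat) :
  layout W K n m -> globals K n m s -> tables K n m s ->
  2 < gA < 30 -> 2 < gS < 30 -> gA != gS -> computes_bit W be bit ->
  (forall c, bit c <= 1) ->
  (forall x, x < stride m n 0 -> mem s (n + 1 + x) = H x /\ H x <= 3) ->
  (forall y, y < K -> mem s (gA * K + y) = 0 /\ mem s (gS * K + y) = 0) ->
  (forall s' t', same_regs 10 s s' ->
     (forall (g : nat) y, y < K -> g != gA -> g != gS -> mem s' (g * K + y) = mem s (g * K + y)) ->
     (forall j k, j < n -> k < m j ->
        mem s' (gS * K + (offset m j + k)) = plane_sum m n (bit \o H) j k) ->
     t' <= t + 1000 * stride m n 0 -> Q s' t') ->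
  wp W (count_planes gA gS be) Q s t.
Proof.
move=> lay gl [tb1 tb2] /andP[gA2 gA30] /andP[gS2 gS30] neg hbe hb hH hz hQ.
have [KE hW N4 /andP[n2 nN] TN] := layout_bounds lay.
have hm2 : forall j, j < n -> 2 <= m j by case: lay.
pose a := bit \o H.
apply: wp_seq; apply: (wp_fill lay gl _ hbe hH); first by lia.
move=> s1 t1 fr1 hm1 ht1.
have gl1 : globals K n m s1 by exact: globals_same fr1 gl.
have [e4 e5 e6 e7] := gl1.
apply: wp_seq; apply: wp_assign => /=; first by lia.
apply: wp_seq; apply: wp_assign => /=; first by lia.
apply: wp_seq; apply: wp_assign; rewrite /upd /= ?e6; first by lia.
(* j voters are summed out and the current array starts at b, the total size of the earlier ones.
   Each array is at most half as large as its predecessor, so [b + 2 * stride m n j] never exceeds 2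
   N. This bounds the space and, the time being charged to b, the cost. *)
pose I i s' t' := exists j b, [/\ i + j = n,
   [/\ same_regs 10 s1 s', regs s' 10 = b & regs s' 11 = j],
   [/\ forall (g : nat) y, y < K -> g != gA -> g != gS -> mem s' (g * K + y) = mem s (g * K + y),
   forall j' k, j' < j -> k < m j' -> mem s' (gS * K + (offset m j' + k)) = plane_sum m n a j' k &
   forall y, offset m j <= y -> y < K -> mem s' (gS * K + y) = 0],
   (forall y, y < stride m n j -> mem s' (gA * K + (b + y)) = residue_sum m n a j y) /\
   (forall y, b + stride m n j <= y -> y < K -> mem s' (gA * K + y) = 0) &
   b + 2 * stride m n j <= 2 * stride m n 0 /\ t' <= t1 + 20 + 100 * b + 100 * j].
apply: (@wp_countdown _ _ _ I n) => //=; first by lia.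
- exists 0, 0; rewrite addn0 /= offset0; split=> //; last by lia.
  + by split=> //; frame.
  + split=> // [g y ly gnA gnS|y _ ly].
      by rewrite hm1 // (negbTE gnA).
    by rewrite hm1 // eq_sym (negbTE neg); have [] := hz _ ly.
  + split=> y ly; last first.
      by move=> lyK; rewrite hm1 // eqxx (ltnNge y) ly /=; have [] := hz _ lyK.
    rewrite hm1 ?eqxx ?ly //;last by lia.
    by rewrite residue_sum0.
- move=> s' t' _ [j [b [/= jn [fr r10 r11] [ho hS _] _ [hb2 ht]]]].
  rewrite add0n in jn; rewrite jn in hS ht.
  apply: hQ => //; last by lia.
  exact: (same_regs_trans _ _ fr1 fr).
move=> i s' t' lti r14 [j [b [ij [fr r10 r11] [ho hS zS] [hA zA] [hb2 ht]]]].
have lj : j < n by lia.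
have sj := strideS m lj.
have q0 : 0 < stride m n j.+1 by exact: stride_gt0.
have mj2 := hm2 _ lj.
have le2 : 2 * stride m n j.+1 <= stride m n j by rewrite sj leq_mul2r mj2 orbT.
have T1 : mem s' (1 * K + j) = stride m n j.
  rewrite ho ?tb1 //; lia.
have T2 : mem s' (1 * K + j.+1) = stride m n j.+1.
  rewrite ho ?tb1 //; lia.
have T3 : mem s' (2 * K + j.+1) = offset m j.+1.
  rewrite ho ?tb2 //; lia.
have oj : offset m j.+1 <= offset m n by exact: offset_mono.
have f4 : regs s' 4 = K by rewrite fr.
have f6 : regs s' 6 = n by rewrite fr.
do 7 (apply: wp_seq; apply: wp_assign;
  rewrite /upd /= ?r14 ?f4 ?r10 ?r11 ?addn1 ?T1 ?T2 ?T3; first by lia).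
rewrite ?T1 ?T2 ?T3.
apply: wp_seq.
have sN := sum_residue_sum a j hm2.
have aN : \sum_(0 <= x < stride m n 0) a x <= stride m n 0.
  rewrite -[X in _ <= X]muln1 -[X in _ <= X * _]subn0 -sum_nat_const_nat.
  by apply: leq_sum => x _; exact: hb.
apply: (@wp_marginalize _ K (stride m n 0) _ _ (m j) (stride m n j.+1) b
  (b + stride m n j) (offset m j) (residue_sum m n a j)); rewrite /upd //=; try lia.
- by rewrite offsetS.
- by rewrite -offsetS; lia.
- by rewrite -sj.
- by rewrite -sj sN.
- by move=> y ly; apply: zA; lia.
- by move=> k lk; apply: zS; rewrite ?leq_addr //; move: oj; rewrite offsetS; lia.
rewrite -sj => s2 t2 fr2 hm2' ht2.
have g13 : regs s2 13 = b + stride m n j by rewrite fr2.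
have g14 : regs s2 14 = i by rewrite fr2 //= /upd /= subn1.
have g11 : regs s2 11 = j.+1 by rewrite fr2.
apply: wp_assign => /=; first by rewrite g13; lia.
split; first by rewrite /upd /= g14.
exists j.+1, (b + stride m n j); split; first by lia.
- rewrite /upd /= g13 g11; split=> //; frame.
  apply: (same_regs_trans (b2 := 10) _ _ fr) => // r lr.
  rewrite /= fr2 /upd /=; last by lia.
  by do 7 (rewrite ifN_eq; last by lia).
- split.
  + move=> g y ly gnA gnS; rewrite /= hm2' // ho // (negbTE gnA) (negbTE gnS).
    by rewrite !big_pred0 ?addn0.
  + move=> j' k lj' lk /=.
    have lk' : offset m j' + k < offset m j.+1.
      apply: (@leq_trans (offset m j'.+1)); last exact: offset_mono.
      by rewrite offsetS ltn_add2l.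
    rewrite hm2'; last by lia.
    rewrite eq_sym (negbTE neg) eqxx /= [X in _ + X + _]big_pred0 // addn0.
    move: lj'; rewrite ltnS leq_eqVlt => /orP[/eqP E|lj'].
      rewrite E in lk lk' *; rewrite zS ?leq_addr //; last by lia.
      rewrite add0n -plane_sumE //; apply: eq_bigl => z.
      by rewrite eqn_add2l.
    rewrite hS // [X in _ + X]big_pred0 ?addn0 // => z.
    have := offset_mono m lj'; rewrite offsetS => h; rewrite ltn_eqF //; move: (z %/ _) => u; lia.
  + move=> y; rewrite offsetS => ly lyK /=; rewrite hm2' //.
    rewrite eq_sym (negbTE neg) eqxx zS //; last by lia.
    rewrite big_pred0 // big_nat_cond big_pred0 // => z; apply/negP => /andP[] /=.
    by rewrite sj -ltn_divLR // => lz; lia.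
- split=> y ly; last move=> lyK; rewrite /= hm2' ?zA //; try lia.
  + rewrite eqxx (negbTE neg) /= [X in _ + X]big_pred0 // add0n addn0 -residue_sumS //.
    by apply: eq_bigl => z; rewrite eqn_add2l.
  + rewrite eqxx (negbTE neg) /= [X in _ + X]big_pred0 // add0n addn0.
    rewrite big_pred0 // => z.
    by have := ltn_pmod z q0; lia.
- lia.
Qed.

(** * Sorting the planes *)

Definition bsort (N : nat) (key : nat -> nat) (L : seq nat) : seq nat :=
  flatten [seq [seq y <- L | key y == v] | v <- iota 0 N.+1].

Lemma perm_bsort N key L : all (fun y => key y <= N) L -> perm_eq (bsort N key L) L.
Proof.
have ur : uniq (iota 0 N.+1) := iota_uniq _ _.
have mr v : v <= N -> v \in iota 0 N.+1 by rewrite mem_iota.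
rewrite /bsort; move: (iota _ _) ur mr => r ur mr hL.
apply/seq.permP => p; rewrite count_flatten -map_comp sumnE big_map.
elim: L hL => [|y L IH] /=; first by rewrite big1.
move=> /andP[ky /IH <-] {IH}.
transitivity (\sum_(v <- r) ((key y == v) * p y + count p [seq z <- L | key z == v])).
  by apply: eq_bigr => v _ /=; case: (key y == v); rewrite /= ?mul1n.
rewrite big_split /=; congr (_ + _).
rewrite (bigD1_seq (key y)) ?mr //= eqxx mul1n big1 ?addn0 // => v.
by rewrite eq_sym => /negbTE->.
Qed.

(** This is stability: inside a bucket the relation r of the previous order survives, so successive
    sorts compose to a lexicographic order. *)
Lemma bsort_pairwise N key (r : rel nat) L : pairwise r L ->
  pairwise (fun x y => (key x < key y) || (key x == key y) && r x y) (bsort N key L).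
Proof.
move=> hL; rewrite /bsort; elim: N.+1 0 => //= {}N IH v.
rewrite pairwise_cat IH andbT; apply/andP; split.
  apply/allrelP => x y; rewrite mem_filter => /andP[/eqP<- _].
  case/flatten_mapP => w; rewrite mem_iota mem_filter => /andP[lw _] /andP[/eqP-> _].
  by rewrite lw.
have /(sub_in_pairwise (P := fun x => key x == v)) := pairwise_filter (fun x => key x == v) hL.
apply; last exact: filter_all.
by move=> x y /eqP kx /eqP ky rxy; rewrite kx ky eqxx rxy orbT.
Qed.

(* A list of planes starts at a head; y is stored as y + 1, and 0 ends a list. *)
Fixpoint chain (next : nat -> nat) (head : nat) (l : seq nat) : Prop :=
  if l is y :: l' then head = y.+1 /\ chain next (next y) l' else head = 0.

Lemma chain_ext next next' head l :
  {in l, next =1 next'} -> chain next head l -> chain next' head l.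
Proof.
elim: l head => //= y l IH head h [-> c]; split=> //.
rewrite -h ?mem_head //; apply: IH c => z zl.
by rewrite h // in_cons zl orbT.
Qed.

(** The list is read from its end because pushing at the head reverses; every bucket then lists its
    planes in the given order, which makes the sort stable. *)
Definition push_all (gL gkey : nat) : prog :=
  20 ::= $7;;
  While $20 (
    20 ::= $20 \- #1;;
    21 ::= Read (At gL $20);;
    22 ::= Read (At gkey $21);;
    Write (At 11 $21) (Read (At 10 $22));;
    Write (At 10 $22) ($21 \+ #1)).

(** Popping also resets all heads to 0, so the next sort finds empty buckets. The loop test is
    nonzero exactly while the bucket number is at most N. *)
Definition pop_all (gL' : nat) : prog :=
  22 ::= #0;; 23 ::= #0;;
  While ($5 \+ #1 \- $22) (
    If (Read (At 10 $22)) (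
      21 ::= Read (At 10 $22) \- #1;;
      Write (At 10 $22) (Read (At 11 $21));;
      Write (At gL' $23) $21;;
      23 ::= $23 \+ #1)
    (22 ::= $22 \+ #1)).

Lemma wp_push_all W K n m gL gkey key L (Q : state -> nat -> Prop) s (t : nat) :
  layout W K n m -> globals K n m s -> gL < 30 -> gL != 10 -> gL != 11 ->
  gkey < 30 -> gkey != 10 -> gkey != 11 ->
  size L = offset m n -> uniq L -> all (fun y => y < offset m n) L ->
  (forall i, i < offset m n -> mem s (gL * K + i) = nth 0 L i) ->
  (forall y, y < offset m n -> mem s (gkey * K + y) = key y /\ key y <= stride m n 0) ->
  (forall v, v < K -> mem s (10 * K + v) = 0) ->
  (forall s' t', same_regs 20 s s' ->
     (forall (g : nat) y, y < K -> g != 10 -> g != 11 -> mem s' (g * K + y) = mem s (g * K + y)) ->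
     (forall v, v < K -> chain (fun y => mem s' (11 * K + y)) (mem s' (10 * K + v))
        [seq y <- L | key y == v]) ->
     t' <= t + 100 * stride m n 0 + 100 -> Q s' t') ->
  wp W (push_all gL gkey) Q s t.
Proof.
move=> lay [r4 r5 r6 r7] gL30 gL10 gL11 gk30 gk10 gk11 sL uL aL hL hk hz hQ.
have [KE hW N4 /andP[n2 nN] TN] := layout_bounds lay.
have lgL : gL * K <= 30 * K by rewrite leq_mul2r; lia.
have lgk : gkey * K <= 30 * K by rewrite leq_mul2r; lia.
pose I x s' t' := [/\ same_regs 20 s s',
   (forall (g : nat) y, y < K -> g != 10 -> g != 11 -> mem s' (g * K + y) = mem s (g * K + y)),
   (forall v, v < K -> chain (fun y => mem s' (11 * K + y)) (mem s' (10 * K + v))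
        [seq y <- drop x L | key y == v]),
   (forall v, v < K -> mem s' (10 * K + v) <= offset m n) &
   t' + 100 * x <= t + 100 * offset m n + 10].
apply: wp_seq; apply: wp_assign => /=; first by lia.
apply: (@wp_countdown _ _ _ I (offset m n)); rewrite /upd //=; first by lia.
- split=> //=; [by frame| | |by lia].
  + by move=> v lv; rewrite drop_oversize ?sL //= hz.
  + by move=> v lv; rewrite hz.
- move=> s' t' r20 [fr ho hc _ ht]; apply: hQ => //; last by lia.
  by move=> v lv; have := hc v lv; rewrite drop0.
move=> x s' t' ltx r20 [fr ho hc hh ht].
have e4 : regs s' 4 = K by rewrite fr.
have dx : drop x L = nth 0 L x :: drop x.+1 L by rewrite (drop_nth 0) ?sL.
set y := nth 0 L x in dx.
have ly : y < offset m n by apply: (allP aL); rewrite mem_nth ?sL.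
have ny : y \notin drop x.+1 L.
  by have := drop_uniq x uL; rewrite dx => /andP[].
have [ky kyN] := hk _ ly.
have E1 : mem s' (gL * K + x) = y by rewrite ho ?hL //; lia.
have E2 : mem s' (gkey * K + y) = key y by rewrite ho //; lia.
have hky := hh (key y).
apply: wp_seq; apply: wp_assign => /=; first by lia.
apply: wp_seq; apply: wp_assign; rewrite /upd /= ?e4 ?r20 ?subn1 /= E1; first by lia.
apply: wp_seq; apply: wp_assign; rewrite /upd /= ?e4 E2; first by lia.
apply: wp_seq; apply: (@wp_write_at _ K); rewrite /upd /= ?e4 //; try lia.
move=> m1 hm1.
apply: (@wp_write_at _ K); rewrite /upd /= ?e4 //; try lia.
move=> m2 hm2; split=> //; split=> /=.
- by frame.
- by move=> g z lz g10 g11; rewrite hm2 // hm1 // (negbTE g10) (negbTE g11) /= ho.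
- move=> v lv; rewrite dx /=.
  rewrite hm2 // eqxx /= eq_sym.
  (* The link written for y does not disturb the lists of later planes, since L has no
     repetition. *)
  have ext (l : seq nat) : {subset l <= drop x.+1 L} ->
     {in l, (fun z => mem s' (11 * K + z)) =1 (fun z => m2 (11 * K + z))}.
    move=> hl z /hl zl /=; have zT : z < offset m n by apply: (allP aL); exact: mem_drop zl.
    rewrite hm2 ?hm1 //=; try lia.
    by case: (z =P y) => // zy; rewrite -zy zl in ny.
  have sub v' : {subset [seq y <- drop x.+1 L | key y == v'] <= drop x.+1 L}.
    by move=> z; rewrite mem_filter => /andP[].
  case: (v =P key y) => [->|ne].
    rewrite eqxx /=; split; first by rewrite addn1.
    rewrite hm2 ?hm1 //=; try lia.
    rewrite eqxx. apply: (chain_ext (ext _ (@sub _)) (hc _ _)); lia.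
  have /negbTE-> : key y != v by apply/eqP => e; apply: ne.
  rewrite hm1 //=; exact: (chain_ext (ext _ (@sub _)) (hc _ _)).
- move=> v lv; rewrite hm2 //= hm1 //=.
  by case: ifP => _; [lia|exact: hh].
- lia.
Qed.

Lemma wp_pop_all W K n m gL b (Q : state -> nat -> Prop) s (t : nat) :
  layout W K n m -> globals K n m s -> gL < 30 -> gL != 10 -> gL != 11 ->
  (forall v, v < K -> chain (fun y => mem s (11 * K + y)) (mem s (10 * K + v)) (b v)) ->
  (forall v, stride m n 0 < v -> b v = [::]) ->
  (forall v, all (fun y => y < offset m n) (b v)) ->
  size (flatten [seq b v | v <- iota 0 (stride m n 0).+1]) = offset m n ->
  (forall s' t', same_regs 20 s s' ->
     (forall (g : nat) y, y < K -> g != 10 -> g != 11 -> g != gL ->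
        mem s' (g * K + y) = mem s (g * K + y)) ->
     (forall v, v < K -> mem s' (10 * K + v) = 0) ->
     (forall i, i < offset m n -> mem s' (gL * K + i) =
        nth 0 (flatten [seq b v | v <- iota 0 (stride m n 0).+1]) i) ->
     t' <= t + 200 * stride m n 0 + 100 -> Q s' t') ->
  wp W (pop_all gL) Q s t.
Proof.
move=> lay [r4 r5 r6 r7] gL30 gL10 gL11 hb hb0 ab sb hQ.
have [KE hW N4 /andP[n2 nN] TN] := layout_bounds lay.
have lgL : gL * K <= 30 * K by rewrite leq_mul2r; lia.
set B := flatten _ in sb hQ.
apply: wp_seq; apply: wp_assign => /=; first by lia.
apply: wp_seq; apply: wp_assign; rewrite /upd /=; first by lia.
(* v is the current bucket, o the number of planes written, c the remaining buckets. A round either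
   advances v or increases o, so N + 1 plus the number of planes bounds the number of rounds. *)
pose I k s' t' := exists v o c, [/\ same_regs 20 s s' /\ regs s' 22 = v,
  regs s' 23 = o /\ o <= offset m n,
  (forall (g : nat) y, y < K -> g != 10 -> g != 11 -> g != gL ->
        mem s' (g * K + y) = mem s (g * K + y)),
  [/\ forall u, u < K -> chain (fun y => mem s' (11 * K + y)) (mem s' (10 * K + u)) (c u),
      forall u, u < v -> c u = [::], forall u, stride m n 0 < u -> c u = [::],
      forall u, all (fun y => y < offset m n) (c u) &
      mkseq (fun i => mem s' (gL * K + i)) o ++
        flatten [seq c u | u <- iota v ((stride m n 0).+1 - v)] = B] &
  [/\ v <= (stride m n 0).+1, k + v + o = (stride m n 0).+1 + offset m n &
      t' <= t + 20 + 50 * (v + o)]].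
apply: (@wp_while _ _ _ I ((stride m n 0).+1 + offset m n)).
- exists 0, 0, b; split=> //; last by split; lia.
  by split=> //; frame.
- move=> k s' t' [v [o [c [[fr r22] _ _ _ [lv _ _]]]]] /=.
  by rewrite r22 fr // r5; lia.
- move=> k s' t' [v [o [c [[fr r22] [r23 _] ho [hc c0 c1 ac mk] [lv kE ht]]]]] /=.
  rewrite r22 fr // r5 => /eqP vN.
  have {vN}vE : v = (stride m n 0).+1 by lia.
  rewrite vE subnn /= cats0 in mk.
  have oE : o = offset m n by rewrite -sb -mk size_mkseq.
  apply: hQ => //; last by lia.
  + move=> u lu; have := hc _ lu.
    suff -> : c u = [::] by [].
    by case: (ltnP u v) => [/c0|] // h; apply: c1; lia.
  + by move=> i li; rewrite -mk nth_mkseq // oE.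
move=> k s' t' [v [o [c [[fr r22] [r23 lo] ho [hc c0 c1 ac mk] [lv kE ht]]]]] /=.
have e4 : regs s' 4 = K by rewrite fr.
rewrite r22 fr // r5 => vN.
have {}lv : v <= stride m n 0 by lia.
have iE : iota v ((stride m n 0).+1 - v) = v :: iota v.+1 ((stride m n 0).+1 - v.+1).
  by rewrite subSn //= subSS.
rewrite iE /= in mk.
have so : o + size (c v) <= offset m n.
  by rewrite -sb -mk !size_cat size_mkseq; lia.
have lvK : v < K by lia.
have hcv := hc _ lvK.
apply: wp_if.
- rewrite /= e4 r22; case: (c v) (ac v) hcv => [_ /= ->|y l /= /andP[ly _] [-> _]]; lia.
- rewrite /= e4 r22 => h0.
  case cv : (c v) (ac v) hcv so mk => [|y l] /=; first by move=> _ /eqP; rewrite (negbTE h0).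
  move=> /andP[ly al] [hv hch] so mk.
  have hy : mem s' (11 * K + y) <= offset m n.
    by case: l al hch {cv so mk} => [|z l] /=; [move=> _ ->|move=> /andP[lz _] [-> _]]; lia.
  apply: wp_seq; apply: wp_assign; rewrite /upd /= ?e4 ?r22 hv; first by lia.
  rewrite addn1 subn1 /=.
  apply: wp_seq; apply: (@wp_write_at _ K); rewrite /upd /= ?e4 ?r22 //; try lia.
  move=> m1 hm1.
  apply: wp_seq; apply: (@wp_write_at _ K); rewrite /upd /= ?e4 ?r23 //; try lia.
  move=> m2 hm2.
  apply: wp_assign; rewrite /upd /= ?r23; first by lia.
  exists k.-1; first by lia.
  exists v, o.+1, (fun u => if u == v then l else c u); split => //=.
  + by split; [frame|].
  + by split; [lia|lia].
  + move=> g z lz g10 g11 gL'; rewrite hm2 // hm1 // (negbTE g10) (negbTE gL') /=.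
    exact: ho.
  + split=> [u lu|u lu|u lu|u|].
    * rewrite hm2 // hm1 // eq_sym (negbTE gL10) /=.
      have ext l' : all (fun y => y < offset m n) l' ->
        {in l', (fun z => mem s' (11 * K + z)) =1 (fun z => m2 (11 * K + z))}.
        move=> al' z /(allP al') lz; rewrite hm2 ?hm1 //=; try lia.
        by rewrite eq_sym (negbTE gL11).
      case: (u =P v) => _; first exact: (chain_ext (ext _ al)).
      exact: (chain_ext (ext _ (ac _)) (hc _ _)).
    * by rewrite (ltn_eqF lu) c0.
    * by rewrite gtn_eqF ?c1 //; lia.
    * by case: ifP.
    * rewrite -[LHS]/(mkseq (fun i => m2 (gL * K + i)) o.+1 ++ flatten
        [seq (if u == v then l else c u) | u <- iota v ((stride m n 0).+1 - v)]).
      rewrite iE mkseqS cat_rcons /= eqxx -mk; congr (_ ++ _).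
        apply/eq_in_map => i; rewrite mem_iota /= add0n => li.
        by rewrite hm2 ?hm1 ?eqxx ?(ltn_eqF li) ?(negbTE gL10) //; lia.
      congr (_ :: (_ ++ flatten _)); first by rewrite hm2 ?eqxx //; lia.
      by apply/eq_in_map => u; rewrite mem_iota => /andP[lu _]; rewrite gtn_eqF.
  + by split; lia.
- rewrite /= e4 r22 => h0.
  have cv : c v = [::] by case: (c v) hcv => //= y l [e]; rewrite e in h0.
  rewrite cv in mk.
  apply: wp_assign; rewrite /= ?r22; first by lia.
  rewrite addn1; exists k.-1; first by lia.
  exists v.+1, o, c; split => //=.
  + by split; [frame|].
  + by split=> // u; rewrite ltnS leq_eqVlt => /orP[/eqP->|/c0].
  + by split; lia.
Qed.

Lemma wp_sort W K n m gL gL' gkey key L (Q : state -> nat -> Prop) s (t : nat) :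
  layout W K n m -> globals K n m s ->
  11 < gL < 30 -> 11 < gL' < 30 -> gkey < 10 ->
  size L = offset m n -> uniq L -> all (fun y => y < offset m n) L ->
  (forall i, i < offset m n -> mem s (gL * K + i) = nth 0 L i) ->
  (forall y, y < offset m n -> mem s (gkey * K + y) = key y /\ key y <= stride m n 0) ->
  (forall v, v < K -> mem s (10 * K + v) = 0) ->
  (forall s' t', same_regs 20 s s' ->
     (forall (g : nat) y, y < K -> g != 10 -> g != 11 -> g != gL' ->
        mem s' (g * K + y) = mem s (g * K + y)) ->
     (forall v, v < K -> mem s' (10 * K + v) = 0) ->
     (forall i, i < offset m n -> mem s' (gL' * K + i) = nth 0 (bsort (stride m n 0) key L) i) ->
     t' <= t + 400 * stride m n 0 -> Q s' t') ->
  wp W (push_all gL gkey;; pop_all gL') Q s t.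
Proof.
move=> lay gl hgL hgL' hgk sL uL aL hL hk hz hQ.
have [KE hW N4 /andP[n2 nN] TN] := layout_bounds lay.
have kN y : y \in L -> key y <= stride m n 0 by move=> /(allP aL)/hk[].
apply: wp_seq; apply: (wp_push_all lay gl _ _ _ _ _ _ sL uL aL hL hk hz); try lia.
move=> s1 t1 fr1 ho1 hc1 ht1.
apply: (wp_pop_all lay (globals_same _ fr1 gl) _ _ _ hc1); try lia.
- move=> v lv; apply/eqP; rewrite -size_eq0 size_filter -leqn0 leqNgt -has_count.
  by apply/hasPn => y /kN; apply: contraL => /eqP->; rewrite -ltnNge.
- by move=> v; apply/allP => y; rewrite mem_filter => /andP[_ /(allP aL)].
- by rewrite -sL -/(bsort _ _ _) (perm_size (perm_bsort _)) //; apply/allP => y /kN.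
move=> s2 t2 fr2 ho2 hz2 hL2 ht2; apply: hQ => //; last by lia.
- exact: (same_regs_trans _ _ fr1 fr2).
- by move=> g y ly g10 g11 gL2; rewrite ho2 // ho1.
Qed.

Lemma offset_split m n y : y < offset m n ->
  exists j k, [/\ j < n, k < m j & y = offset m j + k].
Proof.
elim: n => [|n IH]; first by rewrite offset0.
case: (ltnP y (offset m n)) => [/IH[j [k [lj lk ->]]] _|ly].
  by exists j, k; split=> //; exact: ltnW.
by rewrite offsetS => lt; exists n, (y - offset m n); split=> //; lia.
Qed.

Lemma offset_lt m n j k : j < n -> k < m j -> offset m j + k < offset m n.
Proof. by move=> lj lk; have := offset_mono m lj; rewrite offsetS; lia. Qed.

(** The least significant key comes first. [nb] counts the outcomes without b, so its increasing
    order is the non-increasing order of s(., b). *)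
Definition plane_order (N T : nat) (vt sa nb : nat -> nat) : seq nat :=
  bsort N vt (bsort N sa (bsort N nb (iota 0 T))).

Section PlaneOrder.
Variables (m : nat -> nat) (n N : nat) (vt kt sa nb : nat -> nat).
Hypothesis hvk : forall j k, j < n -> k < m j ->
  vt (offset m j + k) = j /\ kt (offset m j + k) = k.
Hypothesis hN : forall y, y < offset m n -> [/\ vt y <= N, sa y <= N & nb y <= N].

Let L1 := bsort N nb (iota 0 (offset m n)).
Let L2 := bsort N sa L1.
Let L3 := plane_order N (offset m n) vt sa nb.

Let bounded (key : nat -> nat) L : perm_eq L (iota 0 (offset m n)) ->
  (forall y, y < offset m n -> key y <= N) -> all (fun y => key y <= N) L.
Proof.
move=> pL h; apply/allP => y; rewrite (perm_mem pL) mem_iota add0n => /andP[_].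
exact: h.
Qed.

Lemma perm_plane_order1 : perm_eq L1 (iota 0 (offset m n)).
Proof. by apply: perm_bsort; apply: bounded => // y /hN[]. Qed.

Lemma perm_plane_order2 : perm_eq L2 (iota 0 (offset m n)).
Proof.
apply: perm_trans perm_plane_order1; apply: perm_bsort.
by apply: bounded perm_plane_order1 _ => y /hN[].
Qed.

Lemma perm_plane_order : perm_eq L3 (iota 0 (offset m n)).
Proof.
apply: perm_trans perm_plane_order2; apply: perm_bsort.
by apply: bounded perm_plane_order2 _ => y /hN[].
Qed.

Lemma plane_order_pairwise : pairwise (fun x y => (vt x < vt y) || (vt x == vt y) &&
  ((sa x < sa y) || (sa x == sa y) && (nb x <= nb y))) L3.
Proof.
have h0 : pairwise (fun _ _ => true) (iota 0 (offset m n)).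
  by elim: (iota _ _) => //= y l ->; rewrite andbT; apply/allP.
apply: sub_pairwise (bsort_pairwise N vt (bsort_pairwise N sa (bsort_pairwise N nb h0))).
by move=> x y /=; lia.
Qed.

Lemma size_plane_order : size L3 = offset m n.
Proof. by rewrite (perm_size perm_plane_order) size_iota. Qed.

(** Voter numbers are sorted along the planes both before and after the sort, hence form the same
    sequence: the planes of a voter stay in the block of that voter. Sorting all planes at once thus
    still gives one permutation for each voter. *)
Lemma vt_plane_order y : y < offset m n -> vt (nth 0 L3 y) = vt y.
Proof.
move=> ly.
have E : map vt L3 = map vt (iota 0 (offset m n)).
  apply: (sorted_eq leq_trans anti_leq).
  - rewrite sorted_pairwise; last exact: leq_trans.
    rewrite pairwise_map; apply: sub_pairwise plane_order_pairwise.
    by move=> x z /=; lia.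
  - rewrite sorted_pairwise; last exact: leq_trans.
    rewrite pairwise_map; apply: (sub_in_pairwise (P := fun x => x < offset m n)
       (r := ltn)) => [x z /= lx lz lxz| |].
    + have [j [k [lj lk xE]]] := offset_split lx.
      have [j' [k' [lj' lk' zE]]] := offset_split lz.
      rewrite xE zE (hvk lj lk).1 (hvk lj' lk').1 leqNgt; apply/negP => h.
      by have := offset_mono m h; rewrite offsetS; lia.
    + by apply/allP => x; rewrite mem_iota.
    + by rewrite -(sorted_pairwise ltn_trans) iota_ltn_sorted.
  - exact: perm_map perm_plane_order.
have := congr1 (nth 0 ^~ y) E => /=.
by rewrite !(nth_map 0) ?size_plane_order ?size_iota // nth_iota.
Qed.

Lemma nth_plane_order_lt y : y < offset m n -> nth 0 L3 y < offset m n.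
Proof.
move=> ly; have : nth 0 L3 y \in L3 by rewrite mem_nth ?size_plane_order.
by rewrite (perm_mem perm_plane_order) mem_iota.
Qed.

Lemma nth_plane_order j k (y := nth 0 L3 (offset m j + k)) : j < n -> k < m j ->
  y = offset m j + kt y /\ kt y < m j.
Proof.
move=> lj lk; have lt := offset_lt lj lk.
have [j' [k' [lj' lk' E]]] := offset_split (nth_plane_order_lt lt).
have := vt_plane_order lt; rewrite E (hvk lj lk).1 (hvk lj' lk').1 => jj.
by rewrite /y E (hvk lj' lk').2; rewrite jj in lk' *.
Qed.

Lemma plane_order_inj j k l : j < n -> k < m j -> l < m j ->
  kt (nth 0 L3 (offset m j + k)) = kt (nth 0 L3 (offset m j + l)) -> k = l.
Proof.
move=> lj lk ll E.
have [Ek _] := nth_plane_order lj lk; have [El _] := nth_plane_order lj ll.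
have u : uniq L3 by rewrite (perm_uniq perm_plane_order) iota_uniq.
have := nth_uniq 0 (s := L3) (i := offset m j + k) (j := offset m j + l).
rewrite size_plane_order !offset_lt // => /(_ isT isT u).
by rewrite Ek El E eqxx eqn_add2l => /esym/eqP.
Qed.

Lemma plane_order_lex j k l
    (x := nth 0 L3 (offset m j + k)) (y := nth 0 L3 (offset m j + l)) :
  j < n -> k <= l -> l < m j ->
  sa x <= sa y /\ (sa x = sa y -> nb x <= nb y).
Proof.
move=> lj kl ll; move: kl; rewrite leq_eqVlt => /orP[/eqP kl|kl].
  by rewrite /x /y kl; split=> //; lia.
have lk := ltn_trans kl ll.
have := elimT (pairwiseP 0) plane_order_pairwise (offset m j + k) (offset m j + l).
rewrite !inE size_plane_order !offset_lt // ltn_add2l => /(_ isT isT kl).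
rewrite -/x -/y; rewrite (vt_plane_order (offset_lt lj lk)) (vt_plane_order (offset_lt lj ll)).
by rewrite (hvk lj lk).1 (hvk lj ll).1; lia.
Qed.

End PlaneOrder.

(** * Tables *)

(** Register 20 is both the counter and the address of the number of cards, which for voter j is in
    cell j + 1. Plain addresses are used since K is known only at the end. *)
Definition read_size : prog :=
  6 ::= Read #0;; 5 ::= #1;; 7 ::= #0;; 20 ::= $6;;
  While $20 (
    21 ::= Read $20 \+ #1;;
    5 ::= $5 \* $21;;
    7 ::= $7 \+ $21;;
    20 ::= $20 \- #1);;
  4 ::= #4 \* $5.

Definition write_planes : prog :=
  While $21 (
    21 ::= $21 \- #1;;
    22 ::= $22 \- #1;;
    Write (At 3 $22) $20;;
    Write (At 4 $22) $21;;
    Write (At 12 $22) $22).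

(** Entry n, with stride 1 and the total number of planes, is stored too, because the rounds for
    voter j look up entry j + 1. *)
Definition write_tables : prog :=
  10 ::= #1;; 11 ::= $7;;
  Write (At 1 $6) $10;; Write (At 2 $6) $11;;
  20 ::= $6;;
  While $20 (
    21 ::= Read $20 \+ #1;;
    22 ::= $11;;
    20 ::= $20 \- #1;;
    11 ::= $11 \- $21;;
    10 ::= $10 \* $21;;
    Write (At 1 $20) $10;;
    Write (At 2 $20) $11;;
    write_planes).

Lemma wp_read_size W K n m (Q : state -> nat -> Prop) s (t : nat) :
  layout W K n m ->
  mem s 0 = n -> (forall j, j < n -> (mem s j.+1).+1 = m j) ->
  (forall s' t', globals K n m s' -> (forall r, r < 4 -> regs s' r = regs s r) ->
     mem s' = mem s -> t' <= t + 100 * stride m n 0 + 100 -> Q s' t') ->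
  wp W read_size Q s t.
Proof.
move=> lay m0 ma hQ.
have [KE hW N4 /andP[n2 nN] TN] := layout_bounds lay.
have hm2 : forall j, j < n -> 2 <= m j by case: lay.
apply: wp_seq; apply: wp_assign; rewrite /upd /= m0; first by lia.
do 3 (apply: wp_seq; apply: wp_assign; rewrite /upd /=; first by lia).
pose I x s' t' := [/\ forall r, r < 4 -> regs s' r = regs s r,
  regs s' 6 = n, mem s' = mem s, regs s' 5 = stride m n x /\ regs s' 7 + offset m x = offset m n &
  t' + 40 * x <= t + 20 + 40 * n].
apply: wp_seq; apply: (@wp_countdown _ _ _ I n); rewrite //=; first by lia.
- split=> //=; last by lia.
    by move=> r lr; do 4 (rewrite ifN_eq; last by lia).
  by rewrite stride_last.
- move=> s' t' r20 [fr r6 me [r5 r7] ht]; apply: wp_assign => /=; first by lia.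
  rewrite offset0 addn0 in r7.
  apply: hQ => //=; last by lia.
    by split; rewrite /upd //= r5.
  by move=> r lr; rewrite /upd ifN_eq ?fr //; lia.
move=> x s' t' ltx r20 [fr r6 me [r5 r7] ht].
have mx : mem s x.+1 + 1 = m x by rewrite addn1 ma.
have lx : stride m n x <= stride m n 0 by apply: stride_le hm2 _; lia.
have lx1 : stride m n x.+1 <= stride m n 0 by exact: stride_le.
rewrite offsetS in r7; rewrite (strideS _ ltx) mulnC in lx.
apply: wp_seq; apply: wp_assign; rewrite /= r20 me ?mx; first by lia.
apply: wp_seq; apply: wp_assign; rewrite /upd /= ?r5; first by lia.
apply: wp_seq; apply: wp_assign; rewrite /upd /=; first by lia.
apply: wp_assign; rewrite /upd /=; first by lia.
split; first by lia.
split=> //=; last by lia.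
  by move=> r lr; do 4 (rewrite ifN_eq; last by lia); exact: fr.
by split; [rewrite (strideS _ ltx) mulnC|lia].
Qed.

Lemma wp_write_planes W K j o mj (Q : state -> nat -> Prop) s (t : nat) :
  31 * K <= W -> 0 < K -> o + mj <= K -> j <= K -> regs s 4 = K -> regs s 20 = j ->
  regs s 21 = mj -> regs s 22 = o + mj ->
  (forall s' t', same_regs 21 s s' ->
     (forall g y, y < K -> mem s' (g * K + y) =
        if o <= y < o + mj then
          if g == 3 then j else if g == 4 then y - o else if g == 12 then y
          else mem s (g * K + y)
        else mem s (g * K + y)) ->
     t' <= t + 100 * mj + 2 -> Q s' t') ->
  wp W write_planes Q s t.
Proof.
move=> hW hK ho hj r4 r20 r21 r22 hQ.
pose I x s' t' := [/\ same_regs 21 s s', regs s' 22 = o + x,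
  (forall g y, y < K -> mem s' (g * K + y) =
        if o + x <= y < o + mj then
          if g == 3 then j else if g == 4 then y - o else if g == 12 then y
          else mem s (g * K + y)
        else mem s (g * K + y)) & t' + 100 * x <= t + 100 * mj].
apply: (@wp_countdown _ _ _ I mj) => //; first by lia.
- by split=> // g y ly; case: ifP => //; lia.
- by move=> s' t' _ [fr _ hm ht]; apply: hQ => //; [rewrite addn0 in hm|lia].
move=> x s' t' ltx r21' [fr r22' hm ht].
have e4 : regs s' 4 = K by rewrite fr.
have e20 : regs s' 20 = j by rewrite fr.
apply: wp_seq; apply: wp_assign => /=; first by lia.
apply: wp_seq; apply: wp_assign; rewrite /upd /= ?r22' ?r21' !subn1 /= ?addnS /=; first by lia.
apply: wp_seq; apply: (@wp_write_at _ K); rewrite /upd /= ?e20 //; try lia; move=> m1 h1.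
apply: wp_seq; apply: (@wp_write_at _ K); rewrite /upd /= ?e20 //; try lia; move=> m2 h2.
apply: (@wp_write_at _ K); rewrite /upd /= ?e20 //; try lia; move=> m3 h3.
split=> //; split=> //=; [by frame| |by lia].
move=> g y ly; rewrite h3 // h2 // h1 // hm //.
case: (y =P o + x) => [->|ne]; last first.
  rewrite !andbF; have -> : (o + x.+1 <= y) = (o + x <= y) by lia.
  by [].
rewrite !andbT leqnn ltn_add2l ltx addnS ltnn /= addKn.
case: (g =P 3) => [->//|_]; case: (g =P 4) => [->//|_]; by case: (g =P 12).
Qed.

Lemma wp_write_tables W K n m (Q : state -> nat -> Prop) s (t : nat) :
  layout W K n m -> globals K n m s ->
  (forall j, j < n -> (mem s j.+1).+1 = m j) ->
  (forall s' t', same_regs 10 s s' -> tables K n m s' ->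
     (forall j k, j < n -> k < m j -> mem s' (3 * K + (offset m j + k)) = j /\
        mem s' (4 * K + (offset m j + k)) = k) ->
     (forall y, y < offset m n -> mem s' (12 * K + y) = y) ->
     (forall (g : nat) y, y < K -> g \notin [:: 1; 2; 3; 4; 12] ->
        mem s' (g * K + y) = mem s (g * K + y)) ->
     t' <= t + 1000 * stride m n 0 -> Q s' t') ->
  wp W write_tables Q s t.
Proof.
move=> lay [r4 r5 r6 r7] ma hQ.
have [KE hW N4 /andP[n2 nN] TN] := layout_bounds lay.
have hm2 : forall j, j < n -> 2 <= m j by case: lay.
apply: wp_seq; apply: wp_assign; rewrite /upd /=; first by lia.
apply: wp_seq; apply: wp_assign; rewrite /upd /=; first by lia.
apply: wp_seq; apply: (@wp_write_at _ K); rewrite /upd /= ?r6 //; try lia; move=> m1 h1.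
apply: wp_seq; apply: (@wp_write_at _ K); rewrite /upd /= ?r6 //; try lia; move=> m2 h2.
apply: wp_seq; apply: wp_assign; rewrite /upd /= r6; first by lia.
pose I x s' t' := [/\ same_regs 10 s s', regs s' 10 = stride m n x /\ regs s' 11 = offset m x,
  [/\ forall j, x <= j <= n -> mem s' (1 * K + j) = stride m n j /\
     mem s' (2 * K + j) = offset m j,
    forall j k, x <= j -> j < n -> k < m j -> mem s' (3 * K + (offset m j + k)) = j /\
        mem s' (4 * K + (offset m j + k)) = k,
    forall y, offset m x <= y -> y < offset m n -> mem s' (12 * K + y) = y &
    forall (g : nat) y, y < K -> g \notin [:: 1; 2; 3; 4; 12] ->
        mem s' (g * K + y) = mem s (g * K + y)] &
  t' + 100 * x + 100 * offset m x <= t + 60 + 100 * n + 100 * offset m n].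
apply: (@wp_countdown _ _ _ I n); rewrite //=; first by lia.
- split=> //=; first by frame.
  + by rewrite stride_last r7.
  + split.
    * move=> j h; have -> : j = n by lia.
      by rewrite !h2 ?h1 //= ?eqxx ?stride_last; lia.
    * by move=> j k; lia.
    * by move=> y; lia.
    * move=> g y ly; rewrite !inE !negb_or => /and5P[/negbTE g1 /negbTE g2 _ _ _].
      by rewrite h2 // h1 // g1 g2.
  + lia.
- move=> s' t' _ [fr _ [h12 h34 hid ho] ht]; apply: hQ => //.
  + by split=> j lj; have [] := h12 j.
  + by move=> j k; exact: h34.
  + by move=> y; apply: hid; rewrite offset0.
  + lia.
move=> x s' t' ltx r20 [fr [r10 r11] [h12 h34 hid ho] ht].
have mx : mem s' x.+1 + 1 = m x.
  by rewrite -[x.+1]/(0 * K + x.+1) ho //; [rewrite addn1 ma|lia].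
have e4 : regs s' 4 = K by rewrite fr.
have lx : stride m n x <= stride m n 0 by apply: stride_le hm2 _; lia.
have lx1 : stride m n x.+1 <= stride m n 0 by exact: stride_le.
rewrite (strideS _ ltx) mulnC in lx.
have lo : offset m x.+1 <= offset m n by exact: offset_mono.
have oS := offsetS m x.
apply: wp_seq; apply: wp_assign; rewrite /= r20 ?mx; first by lia.
apply: wp_seq; apply: wp_assign; rewrite /upd /= ?r11; first by lia.
apply: wp_seq; apply: wp_assign; rewrite /upd /= ?r20 ?subn1 /=; first by lia.
apply: wp_seq; apply: wp_assign; rewrite /upd /= ?r11 ?oS ?addnK; first by lia.
apply: wp_seq; apply: wp_assign; rewrite /upd /= ?r10; first by lia.
apply: wp_seq; apply: (@wp_write_at _ K); rewrite /upd /= //; try lia; move=> m1' h1'.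
apply: wp_seq; apply: (@wp_write_at _ K); rewrite /upd /= //; try lia; move=> m2' h2'.
apply: (@wp_write_planes _ K x (offset m x) (m x)); rewrite /upd //=; try lia.
rewrite mulnC -(strideS _ ltx) => s3 t3 fr3 h3 ht3.
split; first by rewrite fr3.
split; last by lia.
- apply: (same_regs_trans (b2 := 10) _ _ fr) => // r lr.
  rewrite fr3 /=; last by lia.
  by do 5 (rewrite ifN_eq; last by lia).
- by rewrite !fr3 //= mulnC -strideS.
have oK : forall j, j <= n -> offset m j <= K.
  by move=> j lj; have := offset_mono m lj; lia.
have pK : forall j k, j < n -> k < m j -> offset m j + k < K.
  by move=> j k lj lk; have := oK j.+1 lj; rewrite offsetS; lia.
split.
- move=> j h.
  rewrite !h3 /=; try lia; rewrite !if_same !h2' ?h1' //=; try lia.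
  case: (j =P x) => [->|ne] /=; last by apply: h12; lia.
  by rewrite mulnC -strideS.
- move=> j k lj ljn lk; have := pK _ _ ljn lk => ly.
  rewrite !h3 //=; case: (j =P x) => [E|ne].
    rewrite E in lk *; rewrite leq_addr ltn_add2l lk /=; split=> //; lia.
  have lj' : x < j by lia.
  have := offset_mono m lj'; rewrite offsetS => ljo.
  rewrite [_ + k < _]ltnNge (leq_trans ljo) ?leq_addr // andbF.
  rewrite !h2' // !h1' //=; exact: h34.
- move=> y ly lyn; rewrite h3 /=; last by lia.
  case: ifP => // h; rewrite h2' ?h1' //=; try lia; apply: hid => //; rewrite oS; lia.
- move=> g y ly hg; move: (hg); rewrite !inE !negb_or.
  move=> /and5P[/negbTE g1 /negbTE g2 /negbTE g3 /negbTE g4 /negbTE g12].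
  by rewrite h3 // h2' // h1' // g1 g2 g3 g4 g12 if_same /= ho.
Qed.

(** * The relabeled array and its check *)

(** A table of planes is summed along the coordinates of x. Products of new indices with strides
    give the address of the relabeled cell; plain indices give the number of cards for a. *)
Definition digit_sum (m : nat -> nat) (n : nat) (tab : nat -> nat) (j x : nat) : nat :=
  \sum_(j <= i < n) tab (offset m i + digit m n i x).

(** The array grows in place: as x counts down, the cell x mod q read for x is not above x and so
    still holds the value of the previous level. *)
Definition expand_level (gT gF : nat) : prog :=
  While $20 (
    divmod_pred;;
    Write (At gF $20) (Read (At gT $22) \+ Read (At gF $21))).

Definition expand (gT gF : nat) : prog :=
  10 ::= $6;;
  While $10 (
    22 ::= Read (At 2 $10);;
    12 ::= Read (At 1 $10);;
    10 ::= $10 \- #1;;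
    20 ::= Read (At 1 $10);;
    21 ::= #0;;
    expand_level gT gF).

Lemma wp_expand_level W K N gT gF m q o (c f : nat -> nat)
    (Q : state -> nat -> Prop) s (t : nat) :
  regs s 4 = K -> regs s 12 = q -> regs s 20 = m * q -> regs s 21 = 0 ->
  regs s 22 = o + m ->
  gT < 30 -> gF < 30 -> gT != gF -> 31 * K <= W -> 0 < K -> N <= K ->
  0 < q -> m * q <= K -> q <= K -> o + m <= K ->
  (forall k, k < m -> mem s (gT * K + (o + k)) = c k) ->
  (forall r, r < q -> mem s (gF * K + r) = f r) ->
  (forall k r, k < m -> r < q -> c k + f r <= N) ->
  (forall s' t', same_regs 20 s s' ->
     (forall (g : nat) y, y < K -> g != gF -> mem s' (g * K + y) = mem s (g * K + y)) ->
     (forall x, x < m * q -> mem s' (gF * K + x) = c (x %/ q) + f (x %% q)) ->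
     t' <= t + 100 * (m * q) + 2 -> Q s' t') ->
  wp W (expand_level gT gF) Q s t.
Proof.
move=> r4 r12 r20 r21 r22 hgT hgF neg hW hK hN q0 hmq hq hom hc hf hcf hQ.
have lgT : gT * K <= 30 * K by rewrite leq_mul2r; lia.
have lgF : gF * K <= 30 * K by rewrite leq_mul2r; lia.
pose I x s' t' := [/\ same_regs 20 s s',
   exists k r, [/\ regs s' 21 = r, regs s' 22 = o + k, x = k * q + r, r < q & k <= m],
   (forall (g : nat) y, y < K -> g != gF -> mem s' (g * K + y) = mem s (g * K + y)),
   (forall y, x <= y -> y < m * q -> mem s' (gF * K + y) = c (y %/ q) + f (y %% q)) /\
   (forall y, y < x -> y < q -> mem s' (gF * K + y) = f y) &
   t' + 100 * x <= t + 100 * (m * q)].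
apply: (@wp_countdown _ _ _ I (m * q)) => //; first by lia.
- split=> //; last by split=> y; [lia|move=> _; exact: hf].
  by exists m, 0; rewrite addn0.
- move=> s' t' _ [fr _ ho [hF _] ht]; apply: hQ => //; last by lia.
  by move=> x; apply: hF.
move=> x s' t' ltx x20 [fr [k [r [x21 x22 xE ltr lek]]] ho [hF hf'] ht].
apply: wp_seq; apply: (@wp_divmod_pred _ m q o x k r) => //; try lia.
  by rewrite fr.
move=> s1 t1 k1 r1 fr2 ms1 x20' x21' x22' xE' ltr1 ltk1 ht1.
have fr1 : same_regs 20 s s1 by exact: same_regs_trans fr fr2.
have e4 : regs s1 4 = K by rewrite fr1.
have r1x : r1 <= x by rewrite xE' leq_addl.
have E1 : mem s1 (gT * K + (o + k1)) = c k1 by rewrite ms1 ho ?hc //; lia.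
have E2 : mem s1 (gF * K + r1) = f r1 by rewrite ms1 hf'.
have := hcf _ _ ltk1 ltr1 => hb.
apply: (@wp_write_at _ K); rewrite /= ?e4 ?x20' ?x21' ?x22' ?E1 ?E2; try lia.
move=> m2 h2; split=> //; split=> //=.
- by exists k1, r1; split=> //; exact: ltnW.
- by move=> g y ly gF'; rewrite h2 // (negbTE gF') /= ms1 ho.
- split=> [y ly lyq|y ly lyq]; rewrite h2 ?eqxx //=; try lia.
    case: (y =P x) => [->|ne]; last by rewrite ms1 hF //; lia.
    by rewrite {1 2}xE' divnMDl // divn_small // addn0 modnMDl modn_small.
  by rewrite (ltn_eqF ly) ms1 hf' //; exact: ltnW.
- lia.
Qed.

Lemma digit_sumS m n tab j x : (forall i, i < n -> 2 <= m i) -> j < n ->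
  x < stride m n j ->
  digit_sum m n tab j x = tab (offset m j + x %/ stride m n j.+1)
    + digit_sum m n tab j.+1 (x %% stride m n j.+1).
Proof.
move=> hm lj lx; rewrite /digit_sum big_ltn // /digit [x %% stride m n j]modn_small //.
congr (_ + _); apply: eq_big_nat => i /andP[li lin].
by rewrite modn_dvdm // stride_dvd // ltnW.
Qed.

Lemma wp_expand W K n m gT gF tab (Q : state -> nat -> Prop) s (t : nat) :
  layout W K n m -> globals K n m s -> tables K n m s ->
  gT < 30 -> 2 < gF < 30 -> gT != gF ->
  (forall y, y < offset m n -> mem s (gT * K + y) = tab y) ->
  mem s (gF * K + 0) = 0 ->
  (forall x, digit_sum m n tab 0 x <= stride m n 0) ->
  (forall s' t', same_regs 10 s s' ->
     (forall (g : nat) y, y < K -> g != gF -> mem s' (g * K + y) = mem s (g * K + y)) ->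
     (forall x, x < stride m n 0 -> mem s' (gF * K + x) = digit_sum m n tab 0 x) ->
     t' <= t + 1000 * stride m n 0 -> Q s' t') ->
  wp W (expand gT gF) Q s t.
Proof.
move=> lay [r4 r5 r6 r7] [tb1 tb2] hgT /andP[gF2 gF30] neg hT hF0 hd hQ.
have [KE hW N4 /andP[n2 nN] TN] := layout_bounds lay.
have hm2 : forall j, j < n -> 2 <= m j by case: lay.
have lgT : gT * K <= 30 * K by rewrite leq_mul2r; lia.
have lgF : gF * K <= 30 * K by rewrite leq_mul2r; lia.
apply: wp_seq; apply: wp_assign; rewrite /upd /=; first by lia.
(* u adds up the sizes of the arrays built so far. Sizes at least double at each level, so u is at
   most twice the current one. *)
pose I j s' t' := exists u, [/\ same_regs 10 s s',
   (forall (g : nat) y, y < K -> g != gF -> mem s' (g * K + y) = mem s (g * K + y)),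
   (forall x, x < stride m n j -> mem s' (gF * K + x) = digit_sum m n tab j x) &
   [/\ u <= 2 * stride m n j, j <= n & t' + 100 * j <= t + 20 + 100 * n + 100 * u]].
apply: (@wp_countdown _ _ _ I n); rewrite //=; first by lia.
- exists 1; rewrite stride_last; split=> //; first by frame.
  + by case=> //= _; rewrite hF0 /digit_sum big_geq.
  + by split; lia.
- move=> s' t' _ [u [fr ho hF [hu _ ht]]]; apply: hQ => //; lia.
move=> j s' t' lj r10 [u [fr ho hF [hu _ ht]]].
have e4 : regs s' 4 = K by rewrite fr.
have T1 : mem s' (1 * K + j) = stride m n j by rewrite ho ?tb1 //; lia.
have T2 : mem s' (1 * K + j.+1) = stride m n j.+1 by rewrite ho ?tb1 //; lia.
have T3 : mem s' (2 * K + j.+1) = offset m j.+1 by rewrite ho ?tb2 //; lia.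
have oj : offset m j.+1 <= offset m n by exact: offset_mono.
have lx : stride m n j <= stride m n 0 by apply: stride_le hm2 _; lia.
have q0 : 0 < stride m n j.+1 by exact: stride_gt0.
have sj := strideS m lj.
have le2 : 2 * stride m n j.+1 <= stride m n j by rewrite sj leq_mul2r hm2 // orbT.
do 5 (apply: wp_seq; apply: wp_assign;
  rewrite /upd /= ?r10 ?e4 ?subn1 /= ?T1 ?T2 ?T3; first by lia).
rewrite ?T1 ?T2 ?T3.
apply: (@wp_expand_level _ K (stride m n 0) gT gF (m j) (stride m n j.+1) (offset m j)
  (fun k => tab (offset m j + k)) (digit_sum m n tab j.+1)); rewrite /upd //= -?sj //; try lia.
- by rewrite offsetS.
- by rewrite -offsetS; lia.
- move=> k lk; rewrite ho ?hT //; move: oj; rewrite offsetS; lia.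
- move=> k r lk lr.
  have lx' : k * stride m n j.+1 + r < stride m n j.
    by rewrite sj; have := leq_mul2r (stride m n j.+1) k.+1 (m j); rewrite lk orbT mulSn; lia.
  have := @digit_sumS m n tab j _ hm2 lj lx'.
  rewrite divnMDl // divn_small // addn0 modnMDl modn_small // => <-.
  apply: leq_trans (hd (k * stride m n j.+1 + r)).
  by rewrite /digit_sum [X in _ <= X](big_cat_nat _ (n := j)) ?leq_addl //; exact: ltnW.
move=> s2 t2 fr2 ho2 hF2 ht2; split; first by rewrite fr2.
exists (u + stride m n j); split.
- apply: (same_regs_trans (b2 := 10) _ _ fr) => // r lr.
  rewrite fr2 /=; last by lia.
  by do 5 (rewrite ifN_eq; last by lia).
- by move=> g y ly gF'; rewrite ho2 ?ho.
- by move=> x lx'; rewrite hF2 // -digit_sumS.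
- by split; lia.
Qed.

Definition write_labeling : prog :=
  20 ::= $7;;
  While $20 (
    20 ::= $20 \- #1;;
    21 ::= Read (At 15 $20);;
    22 ::= Read (At 4 $21);;
    Write (At 16 $20) $22;;
    Write (At 17 $20) ($22 \* Read (At 1 (Read (At 3 $21) \+ #1)))).

Lemma wp_write_labeling W K n m (L kt vt : nat -> nat) (Q : state -> nat -> Prop) s (t : nat) :
  layout W K n m -> globals K n m s -> tables K n m s ->
  (forall y, y < offset m n -> [/\ mem s (4 * K + y) = kt y, mem s (3 * K + y) = vt y, vt y < n &
    kt y * stride m n (vt y).+1 <= stride m n 0]) ->
  (forall y, y < offset m n -> mem s (15 * K + y) = L y /\ L y < offset m n) ->
  (forall s' t', same_regs 20 s s' ->
     (forall (g : nat) y, y < K -> g != 16 -> g != 17 -> mem s' (g * K + y) = mem s (g * K + y)) ->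
     (forall y, y < offset m n -> mem s' (16 * K + y) = kt (L y) /\
        mem s' (17 * K + y) = kt (L y) * stride m n (vt (L y)).+1) ->
     t' <= t + 200 * stride m n 0 -> Q s' t') ->
  wp W write_labeling Q s t.
Proof.
move=> lay [r4 r5 r6 r7] [tb1 tb2] hk hL hQ.
have [KE hW N4 /andP[n2 nN] TN] := layout_bounds lay.
have hm2 : forall j, j < n -> 2 <= m j by case: lay.
apply: wp_seq; apply: wp_assign => /=; first by lia.
pose I x s' t' := [/\ same_regs 20 s s',
     (forall (g : nat) y, y < K -> g != 16 -> g != 17 -> mem s' (g * K + y) = mem s (g * K + y)),
     (forall y, x <= y -> y < offset m n -> mem s' (16 * K + y) = kt (L y) /\
        mem s' (17 * K + y) = kt (L y) * stride m n (vt (L y)).+1) &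
     t' + 100 * x <= t + 10 + 100 * offset m n].
apply: (@wp_countdown _ _ _ I (offset m n)); rewrite /upd //=; first by lia.
- split=> //=; [by frame|by move=> y; lia|by lia].
- move=> s' t' _ [fr ho h ht]; apply: hQ => //; last by lia.
  by move=> y; apply: h.
move=> x s' t' ltx r20 [fr ho h ht].
have e4 : regs s' 4 = K by rewrite fr.
have [Lx lLx] := hL _ ltx.
have [kx vx vn bx] := hk _ lLx.
have E1 : mem s' (15 * K + x) = L x by rewrite ho //; lia.
have E2 : mem s' (4 * K + L x) = kt (L x) by rewrite ho //; lia.
have E3 : mem s' (3 * K + L x) = vt (L x) by rewrite ho //; lia.
have E4 : mem s' (1 * K + (vt (L x) + 1)) = stride m n (vt (L x)).+1.
  by rewrite addn1 ho ?tb1 //; lia.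
have s0 : 0 < stride m n (vt (L x)).+1 by exact: stride_gt0.
have sN : stride m n (vt (L x)).+1 <= stride m n 0 by exact: stride_le.
have kN : kt (L x) <= stride m n 0.
  by apply: leq_trans bx; rewrite leq_pmulr.
apply: wp_seq; apply: wp_assign => /=; first by lia.
apply: wp_seq; apply: wp_assign; rewrite /upd /= ?e4 ?r20 ?subn1 /= ?E1; first by lia.
apply: wp_seq; apply: wp_assign; rewrite /upd /= ?e4 ?E2; first by lia.
apply: wp_seq; apply: (@wp_write_at _ K); rewrite /upd /= //; try lia; move=> m1 h1.
have F3 : m1 (3 * K + L x) = vt (L x) by rewrite h1 //=; lia.
have F4 : m1 (1 * K + (vt (L x) + 1)) = stride m n (vt (L x)).+1 by rewrite h1 //=; lia.
apply: (@wp_write_at _ K); rewrite /upd /= ?e4 ?F3 ?F4 //; try lia; move=> m2 h2.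
split=> //; split=> //=.
- by frame.
- by move=> g y ly g16 g17; rewrite h2 // h1 // (negbTE g16) (negbTE g17) /= ho.
- move=> y lxy ly; rewrite !h2 ?h1 //=; try lia.
  case: (y =P x) => [->//|ne]; apply: h => //; lia.
- by lia.
Qed.

Definition majority_code (sig d : nat) : nat := (sig <= 2 * d) + 2 * (2 * d <= sig).

(** Register 10 gets sigma, since each voter has one plane more than cards. With truncated
    subtraction [1 - (x - y)] is the bit of [x <= y], and [(x - y) + (y - x)] is 0 only if x = y. *)
Definition check_outcomes : prog :=
  0 ::= #1;; 10 ::= $7 \- $6;; 20 ::= $5;;
  While $20 (
    20 ::= $20 \- #1;;
    21 ::= Read ($6 \+ #1 \+ Read (At 18 $20));;
    22 ::= #2 \* Read (At 19 $20);;
    Write (At 20 $20) $21;;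
    23 ::= (#1 \- ($10 \- $22)) \+ #2 \* (#1 \- ($22 \- $10));;
    If (($21 \- $23) \+ ($23 \- $21)) (0 ::= #0) Skip);;
  1 ::= #7 \* $4;; 2 ::= #16 \* $4;; 3 ::= #20 \* $4.

Lemma wp_check_outcomes W K n m (F1 F2 H : nat -> nat) (Q : state -> nat -> Prop) s (t : nat) :
  layout W K n m -> globals K n m s ->
  (forall x, x < stride m n 0 -> mem s (n + 1 + x) = H x /\ H x <= 3) ->
  (forall x, x < stride m n 0 -> [/\ mem s (18 * K + x) = F1 x, mem s (19 * K + x) = F2 x,
     F1 x < stride m n 0 & F2 x <= stride m n 0]) ->
  (forall s' t',
     regs s' 0 = all (fun x => H (F1 x) == majority_code (offset m n - n) (F2 x))
       (iota 0 (stride m n 0)) ->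
     regs s' 1 = 7 * K -> regs s' 2 = 16 * K -> regs s' 3 = 20 * K ->
     (forall (g : nat) y, y < K -> g != 20 -> mem s' (g * K + y) = mem s (g * K + y)) ->
     (forall x, x < stride m n 0 -> mem s' (20 * K + x) = H (F1 x)) ->
     t' <= t + 200 * stride m n 0 -> Q s' t') ->
  wp W check_outcomes Q s t.
Proof.
move=> lay [r4 r5 r6 r7] hH hF hQ.
have [KE hW N4 /andP[n2 nN] TN] := layout_bounds lay.
do 3 (apply: wp_seq; apply: wp_assign; rewrite /upd /= ?r6 ?r7; first by lia).
pose ok x := H (F1 x) == majority_code (offset m n - n) (F2 x).
pose I x s' t' := [/\ [/\ regs s' 4 = K, regs s' 6 = n & regs s' 10 = offset m n - n],
     regs s' 0 = all ok (iota x (stride m n 0 - x)) :> nat,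
     (forall (g : nat) y, y < K -> g != 20 -> mem s' (g * K + y) = mem s (g * K + y)),
     (forall y, x <= y -> y < stride m n 0 -> mem s' (20 * K + y) = H (F1 y)) &
     t' + 100 * x <= t + 20 + 100 * stride m n 0].
apply: wp_seq; apply: (@wp_countdown _ _ _ I (stride m n 0)); rewrite //=; first by lia.
- split=> //=; [by rewrite subnn|by move=> y; lia|by lia].
- move=> s' t' _ [[e4 e6 e10] e0 ho h ht]; rewrite subn0 in e0.
  do 2 (apply: wp_seq; apply: wp_assign; rewrite /upd /= ?e4; first by lia).
  apply: wp_assign; rewrite /upd /= ?e4; first by lia.
  apply: hQ => //=; rewrite ?e4; [|lia].
  by move=> x; apply: h.
move=> x s' t' ltx r20 [[e4 e6 e10] e0 ho h ht].
have [f1 f2 l1 l2] := hF _ ltx.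
have [hx hx3] := hH _ l1.
have E1 : mem s' (18 * K + x) = F1 x by rewrite ho //; lia.
have E2 : mem s' (19 * K + x) = F2 x by rewrite ho //; lia.
have E3 : mem s' (n + 1 + F1 x) = H (F1 x).
  by rewrite -[n + 1 + _]/(0 * K + (n + 1 + F1 x)) ho //; lia.
apply: wp_seq; apply: wp_assign => /=; first by lia.
apply: wp_seq; apply: wp_assign; rewrite /upd /= ?e4 ?e6 ?r20 ?subn1 /= ?E1 ?E3; first by lia.
apply: wp_seq; apply: wp_assign; rewrite /upd /= ?e4 ?E2; first by lia.
apply: wp_seq; apply: (@wp_write_at _ K); rewrite /upd /= //; try lia; move=> m1 h1.
apply: wp_seq; apply: wp_assign; rewrite /upd /= ?e10; first by lia.
have -> : 1 - (offset m n - n - 2 * F2 x) + 2 * (1 - (2 * F2 x - (offset m n - n))) =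
  majority_code (offset m n - n) (F2 x).
  by rewrite /majority_code; do 2 case: leqP; lia.
set c := majority_code _ _.
have c3 : c <= 3 by rewrite /c /majority_code; lia.
have iE : iota x (stride m n 0 - x) = x :: iota x.+1 (stride m n 0 - x.+1).
  by rewrite -(subnSK ltx).
have hm1 y : x <= y -> y < stride m n 0 -> m1 (20 * K + y) = H (F1 y).
  move=> lxy ly; rewrite h1 //=; last by lia.
  by case: (y =P x) => [->//|ne]; apply: h => //; lia.
have ho1 (g : nat) y : y < K -> g != 20 -> m1 (g * K + y) = mem s (g * K + y).
  by move=> ly g20; rewrite h1 // (negbTE g20) /= ho.
apply: wp_if => /=; first by lia.
- move=> ne; apply: wp_assign; rewrite /upd /=; first by lia.
  have nok : ok x = false by apply/negbTE; rewrite /ok -/c; apply/eqP; lia.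
  by split=> //; split=> //=; rewrite ?iE /= ?nok //; lia.
- move=> eq; apply: wp_skip.
  have kx : ok x by rewrite /ok -/c; apply/eqP; lia.
  by split=> //; split=> //=; rewrite ?iE /= ?kx //; lia.
Qed.

(** * The whole program *)

Definition a_bit (c : nat) : nat := odd c.
Definition not_b_bit (c : nat) : nat := c < 2.

(** For a code c at most 3, [1 - (2 - c)] is its bit for b. Negating that bit, or subtracting it
    twice from c, gives the two bits without a parity test. *)
Definition not_b_expr : expr := #1 \- (#1 \- (#2 \- $21)).
Definition a_expr : expr := $21 \- #2 \* (#1 \- (#2 \- $21)).

Lemma computes_a_bit W : 6 <= W -> computes_bit W a_expr a_bit.
Proof.
by move=> hW s /=; case: (regs s 21) => [|[|[|[|c]]]] // _; split=> //=; lia.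
Qed.

Lemma computes_not_b_bit W : 6 <= W -> computes_bit W not_b_expr not_b_bit.
Proof.
by move=> hW s /=; case: (regs s 21) => [|[|[|[|c]]]] // _; split=> //=; lia.
Qed.

Lemma digit_lt m n j x : (forall i, i < n -> 2 <= m i) -> j < n -> digit m n j x < m j.
Proof.
move=> hm lj; rewrite /digit ltn_divLR ?stride_gt0 // -strideS //.
by rewrite ltn_mod stride_gt0.
Qed.

(** The induction is on the number d = n - j of digits, starting from the last voter, whose weight
    is 1. *)
Lemma mixed_radix_lt m n j (c : nat -> nat) : j <= n ->
  (forall i, j <= i < n -> c i < m i) ->
  \sum_(j <= i < n) c i * stride m n i.+1 < stride m n j.
Proof.
move=> ljn; rewrite -(subKn ljn); move: (n - j) (leq_subr j n) => d {j ljn}.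
elim: d => [|d IH] ld h; first by rewrite subn0 big_geq // stride_last.
have lt : n - d.+1 < n by lia.
rewrite big_ltn // [X in _ < X]strideS // subnSK //.
have h1 : c (n - d.+1) < m (n - d.+1) by apply: h; lia.
have h2 : \sum_(n - d <= i < n) c i * stride m n i.+1 < stride m n (n - d).
  by apply: IH (ltnW ld) _ => i hi; apply: h; lia.
have : (c (n - d.+1)).+1 * stride m n (n - d) <= m (n - d.+1) * stride m n (n - d).
  by rewrite leq_mul2r h1 orbT.
by rewrite mulSn; lia.
Qed.

Definition relabeled_address m n (r : nat -> nat) x :=
  \sum_(0 <= i < n) r (offset m i + digit m n i x) * stride m n i.+1.

Definition cards_of_a m n x := \sum_(0 <= i < n) digit m n i x.

Definition main_program : prog :=
  read_size;; write_tables;;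
  count_planes 6 7 a_expr;; count_planes 8 9 not_b_expr;;
  (push_all 12 9;; pop_all 13);;
  (push_all 13 7;; pop_all 14);;
  (push_all 14 3;; pop_all 15);;
  write_labeling;;
  expand 17 18;; expand 4 19;;
  check_outcomes.

Lemma plane_sum_le m n a j k : (forall x, a x <= 1) -> plane_sum m n a j k <= stride m n 0.
Proof.
move=> ha; rewrite -[X in _ <= X]muln1 -[X in _ <= X * _]subn0 -sum_nat_const_nat.
rewrite /plane_sum big_mkcond; apply: leq_sum => x _.
by case: ifP.
Qed.

(** The result is stated for numbers and addresses only; r is the labeling on plane positions, and
    the translation into profiles and permutations is left to the final proof. *)
Lemma wp_main W K n m H (Q : state -> nat -> Prop) s :
  layout W K n m -> mem s 0 = n -> (forall j, j < n -> (mem s j.+1).+1 = m j) ->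
  (forall x, x < stride m n 0 -> mem s (n + 1 + x) = H x /\ H x <= 3) ->
  (forall x, n + stride m n 0 < x -> mem s x = 0) ->
  (forall s' t' r,
     (forall j k, j < n -> k < m j -> r (offset m j + k) < m j) ->
     (forall j k l, j < n -> k < m j -> l < m j ->
        r (offset m j + k) = r (offset m j + l) -> k = l) ->
     (forall j k l, j < n -> k <= l -> l < m j ->
        let k' := r (offset m j + k) in let l' := r (offset m j + l) in
        plane_sum m n (a_bit \o H) j k' <= plane_sum m n (a_bit \o H) j l' /\
        (plane_sum m n (a_bit \o H) j k' = plane_sum m n (a_bit \o H) j l' ->
         plane_sum m n (not_b_bit \o H) j k' <= plane_sum m n (not_b_bit \o H) j l')) ->
     regs s' 0 = all (fun x => H (relabeled_address m n r x) ==
        majority_code (offset m n - n) (cards_of_a m n x)) (iota 0 (stride m n 0)) ->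
     (forall j k, j < n -> k < m j ->
        mem s' (regs s' 1 + (offset m j + k)) = plane_sum m n (a_bit \o H) j k) ->
     (forall j k, j < n -> k < m j ->
        mem s' (regs s' 2 + (offset m j + k)) = r (offset m j + k)) ->
     (forall x, x < stride m n 0 ->
        mem s' (regs s' 3 + x) = H (relabeled_address m n r x)) ->
     t' <= 8 * 1000 * stride m n 0 -> Q s' t') ->
  wp W main_program Q s 0.
Proof.
move=> lay m0 ma hH hz hQ.
have [KE hW N4 /andP[n2 nN] TN] := layout_bounds lay.
have hm2 : forall j, j < n -> 2 <= m j by case: lay.
have z0 g y : 0 < g -> mem s (g * K + y) = 0.
  by move=> g0; apply: hz; have := leq_pmull K g0; lia.
have W6 : 6 <= W by lia.
have TK y : y < offset m n -> y < K by lia.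
have NK x : x < stride m n 0 -> x < K by lia.
have nK j : j <= n -> j < K by lia.
have inK x : x < stride m n 0 -> n + 1 + x < K by lia.
have K0 : 0 < K by lia.

apply: wp_seq; apply: (wp_read_size lay m0 ma) => s1 t1 gl1 _ ms1 ht1.
rewrite -ms1 in ma hH z0; clear m0 hz ms1.
apply: wp_seq; apply: (wp_write_tables lay gl1 ma) => s2 t2 fr2 tb2 h34 h12 ho2 ht2.
have gl2 : globals K n m s2 by apply: globals_same fr2 gl1.
have hH2 x : x < stride m n 0 -> mem s2 (n + 1 + x) = H x /\ H x <= 3.
  move=> lx; rewrite -[n + 1 + x]/(0 * K + (n + 1 + x)) ho2 ?inK //.
  exact: hH.
have z2 g y : y < K -> g \notin [:: 0; 1; 2; 3; 4; 12] -> mem s2 (g * K + y) = 0.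
  rewrite in_cons negb_or => ly /andP[g0 hg]; rewrite ho2 // z0 //; lia.
apply: wp_seq; apply: (wp_count_planes lay gl2 tb2 _ _ _ (computes_a_bit W6) _ hH2) => //.
- by move=> c; rewrite /a_bit; case: odd.
- by move=> y ly; rewrite !z2.
move=> s3 t3 fr3 ho3 hS3 ht3.
have gl3 : globals K n m s3 by apply: globals_same fr3 gl2.
have tb3 : tables K n m s3.
  by case: tb2 => a b; split=> j lj; rewrite ho3 ?a ?b ?nK //.
have hH3 x : x < stride m n 0 -> mem s3 (n + 1 + x) = H x /\ H x <= 3.
  move=> lx; rewrite -[n + 1 + x]/(0 * K + (n + 1 + x)) ho3 ?inK //.
  exact: hH2.
apply: wp_seq; apply: (wp_count_planes lay gl3 tb3 _ _ _ (computes_not_b_bit W6) _ hH3) => //.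
- by move=> c; rewrite /not_b_bit; case: (_ < _).
- by move=> y ly; rewrite !ho3 // !z2.
move=> s4 t4 fr4 ho4 hS4 ht4.
have gl4 : globals K n m s4 by apply: globals_same fr4 gl3.
have tb4 : tables K n m s4.
  by case: tb3 => a b; split=> j lj; rewrite ho4 ?a ?b ?nK //.
pose sa y := mem s4 (7 * K + y).
pose nb y := mem s4 (9 * K + y).
pose vt y := mem s4 (3 * K + y).
pose kt y := mem s4 (4 * K + y).
have aE j k : j < n -> k < m j -> sa (offset m j + k) = plane_sum m n (a_bit \o H) j k.
  move=> lj lk; have := offset_lt lj lk => lt.
  by rewrite /sa ho4 ?hS3 ?TK //.
have bE j k : j < n -> k < m j -> nb (offset m j + k) = plane_sum m n (not_b_bit \o H) j k.
  by move=> lj lk; rewrite /nb hS4.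
have hvk j k : j < n -> k < m j -> vt (offset m j + k) = j /\ kt (offset m j + k) = k.
  move=> lj lk; have := offset_lt lj lk => lt.
  by rewrite /vt /kt !ho4 ?ho3 ?TK //; exact: h34.
have hN y : y < offset m n ->
    [/\ vt y <= stride m n 0, sa y <= stride m n 0 & nb y <= stride m n 0].
  move=> /offset_split[j [k [lj lk ->]]]; rewrite aE // bE // (hvk j k lj lk).1.
  split; [by lia|apply: plane_sum_le|apply: plane_sum_le] => x /=.
    by rewrite /a_bit; case: odd.
  by rewrite /not_b_bit; case: (_ < _).
have z4 g y : y < K -> 9 < g -> g != 12 -> mem s4 (g * K + y) = 0.
  move=> ly g9 g12; rewrite ho4 ?ho3 ?z2 //; rewrite ?inE; lia.
have id4 y : y < offset m n -> mem s4 (12 * K + y) = y.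
  by move=> ly; rewrite ho4 ?ho3 ?h12 ?TK //.
have hH4 x : x < stride m n 0 -> mem s4 (n + 1 + x) = H x /\ H x <= 3.
  move=> lx; rewrite -[n + 1 + x]/(0 * K + (n + 1 + x)) ho4 ?inK //.
  exact: hH3.
clear h34 h12 ho2 ho3 ho4 z0 z2 hS3 hS4 hH hH2 hH3 gl1 gl2 gl3 tb2 tb3.
have all_lt L : perm_eq L (iota 0 (offset m n)) ->
   [/\ size L = offset m n, uniq L & all (fun y => y < offset m n) L].
  move=> p; rewrite (perm_size p) (perm_uniq p) iota_uniq size_iota; split=> //.
  by apply/allP => y; rewrite (perm_mem p) mem_iota.
have [sL0 uL0 aL0] := all_lt _ (perm_refl _).
have [sL1 uL1 aL1] := all_lt _ (perm_plane_order1 hN).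
have [sL2 uL2 aL2] := all_lt _ (perm_plane_order2 hN).
apply: wp_seq; apply: (wp_sort (key := nb) lay gl4 _ _ _ sL0 uL0 aL0) => //.
- by move=> i li; rewrite id4 // nth_iota.
- by move=> y /hN[].
- by move=> v lv; rewrite z4.
move=> s5 t5 fr5 ho5 hz5 hL5 ht5.
have gl5 := globals_same (b := 20) isT fr5 gl4.
apply: wp_seq; apply: (wp_sort (key := sa) lay gl5 _ _ _ sL1 uL1 aL1) => //.
- by move=> y ly; rewrite ho5 ?TK //; have [] := hN y ly.
move=> s6 t6 fr6 ho6 hz6 hL6 ht6.
have gl6 := globals_same (b := 20) isT fr6 gl5.
apply: wp_seq; apply: (wp_sort (key := vt) lay gl6 _ _ _ sL2 uL2 aL2) => //.
- by move=> y ly; rewrite ho6 ?ho5 ?TK //; have [] := hN y ly.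
move=> s7 t7 fr7 ho7 hz7 hL7 ht7.
have gl7 := globals_same (b := 20) isT fr7 gl6.
rewrite -/(plane_order _ _ _ _ _) in hL7.
set L := plane_order _ _ _ _ _ in hL7.
have ho47 (g : nat) y : y < K -> g \notin [:: 10; 11; 13; 14; 15] ->
    mem s7 (g * K + y) = mem s4 (g * K + y).
  by rewrite !inE !negb_or => ly /and5P[? ? ? ? ?]; rewrite ho7 // ho6 // ho5.
clear ho5 ho6 ho7 hL5 hL6 hz5 hz6 hz7.
have tb7 : tables K n m s7.
  by case: tb4 => a b; split=> j lj; rewrite ho47 ?a ?b ?nK //.
have lL y : y < offset m n -> nth 0 L y < offset m n.
  by move=> ly; exact: nth_plane_order_lt hN _ ly.
pose r y := kt (nth 0 L y).
have vL y : y < offset m n -> vt (nth 0 L y) = vt y.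
  by move=> ly; exact: vt_plane_order hvk hN _ ly.
apply: wp_seq; apply: (wp_write_labeling (L := nth 0 L) (kt := kt) (vt := vt) lay gl7 tb7).
- move=> y ly; rewrite !ho47 ?TK //.
  have [j [k [lj lk ->]]] := offset_split ly.
  split=> //; rewrite (hvk j k lj lk).1 ?(hvk j k lj lk).2 //.
  apply: (@leq_trans (stride m n j)); last by apply: stride_le hm2 _; lia.
  by rewrite (strideS m lj) leq_mul2r (ltnW lk) orbT.
- by move=> y ly; rewrite hL7 //; split=> //; exact: lL.
move=> s8 t8 fr8 ho8 hr8 ht8.
have gl8 := globals_same (b := 20) isT fr8 gl7.
have tb8 : tables K n m s8.
  by case: tb7 => a b; split=> j lj; rewrite ho8 ?a ?b ?nK //.
have addrE x : digit_sum m n (fun y => r y * stride m n (vt y).+1) 0 x = relabeled_address m n r x.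
  apply: eq_big_nat => i /andP[_ li].
  by rewrite (hvk i _ li (digit_lt _ hm2 li)).1.
have r_lt j k : j < n -> k < m j -> r (offset m j + k) < m j.
  by move=> lj lk; have [] := nth_plane_order hvk hN lj lk.
have addr_lt x : relabeled_address m n r x < stride m n 0.
  apply: mixed_radix_lt (leq0n n) _ => i /andP[_ li].
  by apply: r_lt => //; exact: digit_lt.
have cardsE x : digit_sum m n kt 0 x = cards_of_a m n x.
  apply: eq_big_nat => i /andP[_ li].
  by rewrite (hvk i _ li (digit_lt _ hm2 li)).2.
have cards_le x : cards_of_a m n x <= stride m n 0.
  apply: leq_trans TN; rewrite /cards_of_a /offset !big_nat; apply: leq_sum => i /andP[_ li].
  by rewrite ltnW // digit_lt.
apply: wp_seq; apply: (wp_expand (tab := fun y => r y * stride m n (vt y).+1) lay gl8 tb8) => //.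
- by move=> y ly; rewrite (hr8 y ly).2 vL.
- by rewrite ho8 ?ho47 ?z4 //.
- by move=> x; rewrite addrE ltnW.
move=> s9 t9 fr9 ho9 hF9 ht9.
have gl9 := globals_same (b := 10) isT fr9 gl8.
have tb9 : tables K n m s9.
  by case: tb8 => a b; split=> j lj; rewrite ho9 ?a ?b ?nK //.
apply: wp_seq; apply: (wp_expand (tab := kt) lay gl9 tb9) => //.
- by move=> y ly; rewrite ho9 ?ho8 ?ho47 ?TK //.
- by rewrite ho9 ?ho8 ?ho47 ?z4 //.
- by move=> x; rewrite cardsE.
move=> s10 t10 fr10 ho10 hF10 ht10.
have gl10 := globals_same (b := 10) isT fr10 gl9.
apply: (wp_check_outcomes (F1 := relabeled_address m n r) (F2 := cards_of_a m n) (H := H) lay gl10).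
- move=> x lx; rewrite -[n + 1 + x]/(0 * K + (n + 1 + x)).
  by rewrite ho10 ?ho9 ?ho8 ?ho47 ?inK //; exact: hH4.
- move=> x lx; rewrite hF10 // ho10 ?hF9 // ?addrE ?cardsE ?NK //.
move=> s11 t11 e0 e1 e2 e3 ho11 hR11 ht11.
apply: (hQ _ _ r); rewrite ?e1 ?e2 ?e3 //.
- by move=> j k l lj lk ll; rewrite /r /L => E; apply: (plane_order_inj hvk hN lj lk ll).
- move=> j k l lj kl ll k' l'.
  have lk := leq_ltn_trans kl ll.
  have [Ek _] := nth_plane_order hvk hN lj lk; have [El _] := nth_plane_order hvk hN lj ll.
  have := plane_order_lex hvk hN lj kl ll.
  by rewrite Ek El !aE ?bE //; exact: r_lt.
- move=> j k lj lk; have lt := offset_lt lj lk.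
  rewrite ho11 ?ho10 ?ho9 ?ho8 ?ho47 ?TK //; exact: aE.
- move=> j k lj lk; have lt := offset_lt lj lk.
  by rewrite ho11 ?ho10 ?ho9 ?(hr8 _ lt).1 ?TK //.
(* The bounds of the phases add up to 6700 N + 100, which is below 8000 N as N is at least 4. *)
- lia.
Qed.

(** * Mixed radix digits *)

Section MixedRadix.
Variables (n : nat) (m : nat -> nat).
Hypothesis hm : forall i, i < n -> 2 <= m i.

Lemma sum_digits x j : j <= n ->
  \sum_(j <= i < n) digit m n i x * stride m n i.+1 = x %% stride m n j.
Proof.
move=> ljn; rewrite -(subKn ljn); move: (n - j) (leq_subr j n) => d {j ljn}.
elim: d => [|d IH] ld; first by rewrite subn0 big_geq // stride_last modn1.
have lt : n - d.+1 < n by lia.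
rewrite big_ltn // subnSK // (IH (ltnW ld)) /digit subnSK //.
by rewrite -(modn_dvdm x (stride_dvd (j := n - d) (i := n - d.+1) m _ _)) -?divn_eq //; lia.
Qed.

(** Terms before j are multiples of stride j and vanish in the remainder; terms after j add up to
    less than stride j+1 and vanish in the quotient. *)
Lemma digit_mixed_radix c j : (forall i, i < n -> c i < m i) -> j < n ->
  digit m n j (\sum_(0 <= i < n) c i * stride m n i.+1) = c j.
Proof.
move=> hc lj; rewrite (big_cat_nat _ (n := j)) //=; last exact: ltnW.
have dv : stride m n j %| \sum_(0 <= i < j) c i * stride m n i.+1.
  rewrite big_nat; apply: dvdn_sum => i /andP[_ li].
  by rewrite dvdn_mull // stride_dvd //; exact: ltnW.
rewrite /digit -modnDml (eqP dv) add0n modn_small; last first.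
  by apply: mixed_radix_lt (ltnW lj) _ => i /andP[_]; exact: hc.
rewrite big_ltn // divnMDl ?stride_gt0 // divn_small ?addn0 //.
by apply: mixed_radix_lt lj _ => i /andP[_]; exact: hc.
Qed.
End MixedRadix.

(** * Profiles and their addresses *)

Section Encoding.
Variables (n : nat) (alpha : 'I_n -> nat) (m : nat -> nat).
Hypothesis hm : forall i, i < n -> 2 <= m i.
Hypothesis ma : forall i : 'I_n, m i = (alpha i).+1.
Implicit Types (z : profile alpha) (i : 'I_n).

Lemma num_profilesE : num_profiles alpha = stride m n 0.
Proof. by rewrite /stride big_mkord; apply: eq_bigr => i _; rewrite ma. Qed.

Lemma strideE i : \prod_(j < n | i < j) (alpha j).+1 = stride m n i.+1.
Proof.
rewrite /stride (big_nat_widenl _ 0) // big_mkord.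
by apply: eq_bigr => j _; rewrite ma.
Qed.

Lemma addressE z : address z = \sum_(i < n) z i * stride m n i.+1.
Proof. by apply: eq_bigr => i _; rewrite strideE. Qed.

(** A coordinate as a function on all natural numbers, 0 outside the voters, in the form required by
    the mixed radix lemmas. *)
Definition coord z (j : nat) : nat := oapp (fun i => z i : nat) 0 (insub j).

Lemma coordE z i : coord z i = z i.
Proof. by rewrite /coord insubT //= => p; congr (nat_of_ord (z _)); exact: val_inj. Qed.

Lemma address_coord z : address z = \sum_(0 <= j < n) coord z j * stride m n j.+1.
Proof. by rewrite addressE big_mkord; apply: eq_bigr => i _; rewrite coordE. Qed.

Lemma coord_lt z j : j < n -> coord z j < m j.
Proof. by move=> lj; rewrite (coordE z (Ordinal lj)) (ma (Ordinal lj)) ltn_ord. Qed.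

Lemma address_lt z : address z < stride m n 0.
Proof. by rewrite address_coord; apply: mixed_radix_lt => // i /andP[_]; exact: coord_lt. Qed.

Lemma digit_address z i : digit m n i (address z) = z i.
Proof. by rewrite address_coord digit_mixed_radix ?coordE // => j; exact: coord_lt. Qed.

Definition profile_at (x : nat) : profile alpha := [ffun i : 'I_n => inord (digit m n i x)].

Lemma profile_atE x i : profile_at x i = digit m n i x :> nat.
Proof. by rewrite ffunE inordK // -ma digit_lt. Qed.

Lemma profile_atK x : x < stride m n 0 -> address (profile_at x) = x.
Proof.
move=> lx; rewrite addressE -[RHS](modn_small lx) -(sum_digits m x (leq0n n)) big_mkord.
by apply: eq_bigr => i _; rewrite profile_atE.
Qed.

Lemma addressK z : profile_at (address z) = z.
Proof. by apply: profile_eq => i; rewrite profile_atE digit_address. Qed.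

Lemma sum_profiles (f : nat -> nat) :
  \sum_(z : profile alpha) f (address z) = \sum_(0 <= x < stride m n 0) f x.
Proof.
rewrite big_mkord (reindex (fun z => Ordinal (address_lt z))) //=.
exists (fun x : 'I_(stride m n 0) => profile_at x) => [z _|x _]; first exact: addressK.
by apply: val_inj; rewrite /= profile_atK.
Qed.

(** A general P serves both for outcomes with a and for outcomes without b. *)
Lemma card_plane_sum (P : pred {set candidate}) (h : voting alpha)
    (a : nat -> nat) i (k : 'I_(alpha i).+1) :
  (forall z, a (address z) = P (h z)) ->
  #|[set z : profile alpha | (z i == k) && P (h z)]| = plane_sum m n a i k.
Proof.
move=> aP; rewrite cardsE -sum1_card big_mkcond /plane_sum [in RHS]big_mkcond -sum_profiles.
apply: eq_bigr => z _; rewrite unfold_in /= digit_address aP -val_eqE.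
by case: (_ == _); case: (P _).
Qed.

Lemma sigmaE : sigma alpha = offset m n - n.
Proof.
rewrite /offset big_mkord /sigma [in RHS](eq_bigr (fun i => alpha i + 1)) => [|i _].
  by rewrite big_split /= sum_nat_const card_ord muln1 addnK.
by rewrite ma addn1.
Qed.

Lemma plane_addressE i (k : 'I_(alpha i).+1) : plane_address k = offset m i + k.
Proof.
rewrite /plane_address /offset (big_nat_widen 0 i n) ?(ltnW (ltn_ord i)) // big_mkord.
by congr (_ + _); apply: eq_bigr => j _; rewrite ma.
Qed.
End Encoding.

Lemma code_le3 S : code S <= 3.
Proof. by rewrite /code; lia. Qed.

Lemma code_inj : injective code.
Proof.
move=> A B; rewrite /code => h; apply/setP => -[]; move: h; lia.
Qed.

Lemma code_majority (n : nat) (alpha : 'I_n -> nat) (z : profile alpha) :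
  code (majority z) = majority_code (sigma alpha) (votes_a z).
Proof. by rewrite /code !(majorityE z).1 !(majorityE z).2. Qed.

(** * Correctness and running time *)

Lemma main_program_correct (n : nat) (alpha : 'I_n -> nat) (h : voting alpha) s :
  2 <= n -> (forall i : 'I_n, 1 <= alpha i) -> input_state h s ->
  exists (t : nat) (s' : state) (rho : labeling alpha),
    exec (8 * 1000 * num_profiles alpha) main_program s t s' /\
    t <= 8 * 1000 * num_profiles alpha /\
    a_monotone (relabel h rho) /\ ties_ordered (relabel h rho) /\
    output_state h rho s'.
Proof.
move=> n2 a1 [m0 malpha harr hz _].
(* The sizes are read off the memory, which defines m on all natural numbers without reference to
   the voter type. *)
pose m j := (mem s j.+1).+1.
have ma (i : 'I_n) : m i = (alpha i).+1 by rewrite /m malpha.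
have hm i : i < n -> 2 <= m i by move=> li; have := a1 (Ordinal li); rewrite -malpha.
have NE := num_profilesE ma; rewrite NE.
have lay : layout (8 * 1000 * stride m n 0) (4 * stride m n 0) n m.
  by split=> //; rewrite mulnA leq_mul2r orbC.
pose H x := mem s (n + 1 + x).
have HE (z : profile alpha) : H (address z) = code (h z) by rewrite /H addn1 harr.
have hH x : x < stride m n 0 -> mem s (n + 1 + x) = H x /\ H x <= 3.
  by move=> lx; split=> //; rewrite -(profile_atK hm ma lx) HE code_le3.
have hz' x : n + stride m n 0 < x -> mem s x = 0 by rewrite -NE; exact: hz.
have aE (z : profile alpha) : (a_bit \o H) (address z) = (true \in h z).
  by rewrite /= HE /a_bit /code; case: (true \in _); case: (false \in _).
have bE (z : profile alpha) : (not_b_bit \o H) (address z) = (false \notin h z).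
  by rewrite /= HE /not_b_bit /code; case: (true \in _); case: (false \in _).
have saE (i : 'I_n) (k : 'I_(alpha i).+1) : s_count h k true = plane_sum m n (a_bit \o H) i k.
  exact: (card_plane_sum (P := fun S => true \in S) hm ma k aE).
have nbE (i : 'I_n) (k : 'I_(alpha i).+1) :
    #|[set z : profile alpha | (z i == k) && (false \notin h z)]| =
    plane_sum m n (not_b_bit \o H) i k.
  exact: (card_plane_sum (P := fun S => false \notin S) hm ma k bE).
suff [t' [s' [ex [rho [ht [c1 [c2 c3]]]]]]] : wp (8 * 1000 * stride m n 0) main_program
    (fun s' t' => exists rho : labeling alpha, t' <= 8 * 1000 * stride m n 0 /\
      a_monotone (relabel h rho) /\ ties_ordered (relabel h rho) /\ output_state h rho s') s 0.
  by exists t', s', rho.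
apply: (wp_main lay m0 (fun j _ => erefl (m j)) hH hz').
move=> s' t' r r_lt r_inj r_lex e0 e1 e2 e3 ht'.
have r_lt' (i : 'I_n) (k : 'I_(alpha i).+1) : r (offset m i + k) < (alpha i).+1.
  by have := r_lt i k (ltn_ord i); rewrite ma; apply.
pose f (i : 'I_n) (k : 'I_(alpha i).+1) := Ordinal (r_lt' i k).
have f_inj i : injective (@f i).
  move=> k l /(congr1 val) /= E; apply: val_inj => /=.
  by apply: (r_inj i) E; rewrite ?ma.
pose rho : labeling alpha := fun i => perm (@f_inj i).
have rhoE (i : 'I_n) (k : 'I_(alpha i).+1) : rho i k = r (offset m i + k) :> nat.
  by rewrite permE.
have F1 (z : profile alpha) : relabeled_address m n r (address z) = address (relabel_profile rho z).
  rewrite /relabeled_address [RHS](addressE ma) big_mkord; apply: eq_bigr => i _.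
  by rewrite (digit_address hm ma) ffunE rhoE.
have F2 (z : profile alpha) : cards_of_a m n (address z) = votes_a z.
  rewrite /cards_of_a big_mkord; apply: eq_bigr => i _.
  by rewrite (digit_address hm ma).
have lex (i : 'I_n) (k l : 'I_(alpha i).+1) : k <= l ->
    s_count h (rho i k) true <= s_count h (rho i l) true /\
    (s_count h (rho i k) true = s_count h (rho i l) true ->
     s_count h (rho i l) false <= s_count h (rho i k) false).
  move=> kl; have [|le eq] := r_lex i k l (ltn_ord i) kl; first by rewrite ma ltn_ord.
  rewrite !saE !rhoE; split=> // /eq.
  (* All planes of a voter have equally many cells, so more outcomes without b means fewer with
     b. *)
  have := s_count_compl h (rho i k) false; have := s_count_compl h (rho i l) false.
  by rewrite (card_plane_const (rho i k) (rho i l)) !nbE !rhoE; lia.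
exists rho; split=> //; split; last split.
- by move=> i k l kl; rewrite !s_count_relabel; exact: (lex _ _ _ kl).1.
(* The program orders the ties of every voter, in particular those that [ties_ordered] singles
   out. *)
- by move=> i _ _ k l kl; rewrite !s_count_relabel; exact: (lex _ _ _ kl).2.
split.
- rewrite e0; congr nat_of_bool; apply/allP/forallP => [a z|a x].
  + have : address z \in iota 0 (stride m n 0) by rewrite mem_iota (address_lt ma).
    move=> /a; rewrite F1 F2 HE -(sigmaE ma) -code_majority => /eqP E.
    by apply/eqP; exact: code_inj.
  + rewrite mem_iota add0n => /andP[_ lx]; have /eqP E := a (profile_at alpha m x).
    by rewrite -(profile_atK hm ma lx) F1 F2 HE -(sigmaE ma) -code_majority -E.
- by move=> i k; rewrite (plane_addressE ma) e1 ?saE // ma ltn_ord.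
- by move=> i k; rewrite (plane_addressE ma) e2 ?rhoE // ma ltn_ord.
- by move=> z; rewrite e3 ?(address_lt ma) // F1 HE.
Qed.

Theorem theorem20 :
  (forall (n : nat) (alpha : 'I_n -> nat) (h : voting alpha),
     2 <= n -> (forall i : 'I_n, 1 <= alpha i) ->
     (forall rho : labeling alpha,
        a_monotone (relabel h rho) -> ties_ordered (relabel h rho) ->
        (is_DAV h <->
         forall z : profile alpha, relabel h rho z = majority z)) /\
     (is_DAV h <->
      exists rho : labeling alpha,
        a_monotone (relabel h rho) /\
        forall z : profile alpha, relabel h rho z = majority z)) /\
  (exists (p : prog) (C : nat),
     forall (n : nat) (alpha : 'I_n -> nat) (h : voting alpha),
       2 <= n -> (forall i : 'I_n, 1 <= alpha i) ->
       forall s : state, input_state h s ->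
       exists (t : nat) (s' : state) (rho : labeling alpha),
         exec (C * num_profiles alpha) p s t s' /\
         t <= C * num_profiles alpha /\
         a_monotone (relabel h rho) /\ ties_ordered (relabel h rho) /\
         output_state h rho s').
Proof.
split=> [n alpha h _ a1|].
  split=> [rho mono ties|]; last exact: DAV_iff_exists.
  exact: DAV_iff_sorted.
exists main_program, (8 * 1000) => n alpha h n2 a1 s.
exact: main_program_correct.
Qed.
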